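(* Let $B$ be a real $N\times N$ matrix such that $\sup_{t\in\mathbb{R}}\|\exp(-tB)\|<\infty$, and let $\mathscr{L}_0=\Delta+\langle Bx,\nabla\rangle$ on $\mathbb{R}^N$. Let $v:\mathbb{R}^N\to\mathbb{R}$ be a smooth solution to $\mathscr{L}_0 v=0$ in $\mathbb{R}^N$. If $\inf_{\mathbb{R}^N} v>-\infty$, then $v$ is constant.
   Context: $\Delta$, $\nabla$ and $\langle\cdot,\cdot\rangle$ are the Laplace operator, the gradient and the inner product in $\mathbb{R}^N$, so $\mathscr{L}_0 v(x)=\Delta v(x)+\langle Bx,\nabla v(x)\rangle$. $\|\cdot\|$ is the operator norm. Smooth means $C^\infty$. *)

(* Defs.v *)
From mathcomp Require Import all_boot all_order all_algebra.
From mathcomp Require Import all_classical all_reals all_analysis.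
Set Implicit Arguments.
Unset Strict Implicit.
Unset Printing Implicit Defensive.
Import Order.TTheory GRing.Theory Num.Theory.
Import numFieldNormedType.Exports.
Local Open Scope classical_set_scope.
Local Open Scope ring_scope.

(* Points of R^N are column vectors, so that B x is [B *m x].  The norm `|x|
   that MathComp-Analysis puts on matrices is the sup norm; [enorm] is the
   Euclidean one. *)

Definition dotv (R : realType) (N : nat) (x y : 'cV[R]_N) : R :=
  \sum_(i < N) x i ord0 * y i ord0.

Definition enorm (R : realType) (N : nat) (x : 'cV[R]_N) : R :=
  Num.sqrt (dotv x x).

Definition opnorm (R : realType) (N : nat) (A : 'M[R]_N) : R :=
  sup [set enorm (A *m x) | x in [set x : 'cV[R]_N | enorm x <= 1]].

(* The series converges for every A, so [limn] never takes its default value. *)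
Definition expmx (R : realType) (N : nat) (A : 'M[R]_N) : 'M[R]_N :=
  limn (series (fun k : nat => (k`!%:R)^-1 *: A ^+ k)).

Definition partial (R : realType) (N : nat) (i : 'I_N) (f : 'cV[R]_N -> R) :
    'cV[R]_N -> R :=
  'D_(delta_mx i ord0) f.

Definition grad (R : realType) (N : nat) (f : 'cV[R]_N -> R) (x : 'cV[R]_N) :
    'cV[R]_N :=
  \col_i partial i f x.

Definition laplacian (R : realType) (N : nat) (f : 'cV[R]_N -> R)
    (x : 'cV[R]_N) : R :=
  \sum_(i < N) partial i (partial i f) x.

Definition L0 (R : realType) (N : nat) (B : 'M[R]_N) (f : 'cV[R]_N -> R)
    (x : 'cV[R]_N) : R :=
  laplacian f x + dotv (B *m x) (grad f x).

(* C^oo: the partial derivatives of all orders exist and are continuous.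
   [derive] is a total operator, hence the explicit [derivable]. *)
Definition smooth (R : realType) (N : nat) (f : 'cV[R]_N -> R) : Prop :=
  forall s : seq 'I_N,
    continuous (foldr (@partial R N) f s) /\
    forall (i : 'I_N) (x : 'cV[R]_N),
      derivable (foldr (@partial R N) f s) x (delta_mx i ord0).

(* Main.v *)
Require Import Defs.
From mathcomp Require Import all_boot all_order all_algebra.
From mathcomp Require Import all_classical all_reals all_analysis.
From mathcomp Require Import ring lra.
Import Order.TTheory GRing.Theory Num.Theory.
Import numFieldNormedType.Exports.
Local Open Scope classical_set_scope.
Local Open Scope ring_scope.

(** The proof shows that ln (v - c) is convex for every constant c below the infimum
    of v, and that this leaves no room for a nonconstant solution.

    Let u = v - c > 0 and f = ln u. Then f satisfies
    Delta f + |grad f|^2 + <B x, grad f> = 0. If xi is a direction and h = <D^2 f xi, xi>, the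
    equation differentiated twice along xi ([hessian_equation]) reads
    Delta h + <B x + 2 grad f, grad h> + 2 |D^2 f xi|^2 + 2 <D^2 f xi, B xi> = 0.
    The term 2 |D^2 f xi|^2 is at least a multiple of h^2 and forces h >= 0 by a maximum
    principle with a cutoff ([max_principle]), provided that two obstacles are removed.

    The last term has no sign. Here the hypothesis on B enters: the set of all xi whose
    whole orbit exp (t B) xi stays in a fixed ball is compact and invariant under the flow.
    When h is minimised over x and over xi in this set, the minimum is critical along the flow
    through xi, which says exactly that <D^2 f xi, B xi> = 0 ([invariant_critical]).

    The drift B x + 2 grad f is unbounded. A Bernstein argument, the maximum principle for
    |grad f|^2 with a quadratic cutoff, shows that |grad f|^2 grows at most quadratically
    ([gradient_growth]). A drift of linear growth is harmless for the cutoff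
    1 - w ln (1 + |x|^2), whose gradient is O (w / |x|); letting w tend to 0 gives
    D^2 f >= 0 ([hessian_nonneg], [log_convexity]).

    In terms of v the convexity reads (D v)^2 <= (v - c) D^2 v in every direction. At the origin
    the equation gives Delta v = 0, so all second derivatives in coordinate directions vanish
    there, and hence so does grad v. By convexity v 0 = min v. Now c may tend to v 0 in the
    midpoint inequality (v (x / 2) - c)^2 <= (v 0 - c) (v x - c), and v (x / 2) = v 0 follows. *)

Set Implicit Arguments.
Unset Strict Implicit.
Unset Printing Implicit Defensive.

(** * Derivatives along lines and mixed partial derivatives *)

Section Lines.
Variables (R : realType) (V : normedModType R).
Implicit Types (f g : V -> R) (x y a b v : V) (s t h c : R).

Lemma is_derive_line f x v s : derivable f (s *: v + x) v ->
  is_derive s 1 (fun t => f (t *: v + x)) ('D_v f (s *: v + x)).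
Proof.
have E : (fun h : R => h^-1 *: (f ((h *: (1 : R) + s) *: v + x) - f (s *: v + x)))
   = (fun h : R => h^-1 *: (f (h *: v + (s *: v + x)) - f (s *: v + x))).
  apply/funext => h; congr (_ *: (f _ - _)).
  by rewrite [h *: 1]mulr1 scalerDl addrA.
move=> df; apply: DeriveDef; first by rewrite /derivable /= E.
by rewrite /derive /= E.
Qed.

Lemma line_mvt f v : (forall y, derivable f y v) ->
  forall x h, exists2 c, `|c| <= `|h| & f (h *: v + x) - f x = h * 'D_v f (c *: v + x).
Proof.
move=> df x h; pose g t := f (t *: v + x).
have dg t : is_derive t 1 g ('D_v f (t *: v + x)) by exact: is_derive_line.
have cg (i : interval R) : {within [set` i], continuous g}.
  by apply: derivable_within_continuous => t _; case: (dg t).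
have g0 : g 0 = f x by rewrite /g scale0r add0r.
have [h0|h0] := leP 0 h.
  have [c] := @MVT_segment _ g _ 0 h h0 (fun t _ => dg t) (cg _).
  rewrite in_itv /= => /andP[c0 ch] E; exists c; first by rewrite !ger0_norm.
  by rewrite -g0 -/(g h) E subr0 mulrC.
have [c] := @MVT_segment _ g _ h 0 (ltW h0) (fun t _ => dg t) (cg _).
rewrite in_itv /= => /andP[ch c0] E; exists c.
  by rewrite !ler0_norm ?lerN2// ltW.
by rewrite -g0 -/(g h) -opprB E sub0r mulrN opprK mulrC.
Qed.

(** Only the derivative along [b] has to be continuous: the increment along [h (a + b)]
    splits into one along [h a] at [x] and one along [h b] at the moving point [x + h a],
    and the mean value theorem turns the second into a value of ['D_b f] near [x]. *)
Lemma derive_dirD f a b : (forall y, derivable f y a) ->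
    (forall y, derivable f y b) -> continuous ('D_b f) ->
  forall x, is_derive x (a + b) f ('D_a f x + 'D_b f x).
Proof.
move=> da db cb x.
suff H : h^-1 *: (f (h *: (a + b) + x) - f x) @[h --> 0^'] -->
    'D_a f x + 'D_b f x.
  by apply: DeriveDef; [apply/cvg_ex; eexists; exact: H|exact/cvg_lim].
have E h : h^-1 *: (f (h *: (a + b) + x) - f x) =
    h^-1 *: (f (h *: a + x) - f x) +
    h^-1 *: (f (h *: b + (h *: a + x)) - f (h *: a + x)).
  rewrite -scalerDr; congr (_ *: _); rewrite [RHS]addrC subrKA.
  by rewrite scalerDr [h *: a + h *: b]addrC -addrA.
rewrite (funext E); apply: cvgD; first exact: (da x).
apply/cvgrPdist_le => /= e e0.
have /cvgrPdist_le /(_ e e0) /nbhs_ballP [d /= d0 Hd] := cb x.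
near=> h.
have h0 : h != 0 by near: h; exact: nbhs_dnbhs_neq.
have [c ch ->] := line_mvt db (h *: a + x) h.
rewrite [h^-1 *: _]mulrA mulVf// mul1r; apply: Hd.
rewrite -ball_normE /ball_ /= addrA opprD addrCA addrN addr0 normrN.
rewrite (le_lt_trans (ler_normD _ _))// !normrZ.
have hd : `|h| < d / (`|a| + `|b| + 1).
  by near: h; apply: dnbhs0_lt; rewrite divr_gt0// ltr_wpDl// addr_ge0.
rewrite ltr_pdivlMr ?ltr_wpDl ?addr_ge0// in hd.
apply: le_lt_trans hd; rewrite mulrDr mulr1 mulrDr ler_wpDr//.
by rewrite addrC lerD2l ler_wpM2r.
Unshelve. all: by end_near. Qed.

(** Two applications of the mean value theorem, one to the increment of [f] along [h b] and
    one to ['D_a f]. *)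
Lemma second_difference f a b : (forall y, derivable f y a) ->
    (forall y, derivable ('D_a f) y b) ->
  forall x h, h != 0 -> exists y, `|x - y| <= `|h| * (`|a| + `|b|) /\
    f (h *: b + (h *: a + x)) - f (h *: a + x) - (f (h *: b + x) - f x) =
    h ^+ 2 * 'D_b ('D_a f) y.
Proof.
move=> da dba x h h0.
pose g y := f (h *: b + y) - f y.
have dsh y : is_derive y a (fun y => f (h *: b + y)) ('D_a f (h *: b + y)).
  have E : (fun t : R => t^-1 *: (f (h *: b + (t *: a + y)) - f (h *: b + y))) =
     (fun t : R => t^-1 *: (f (t *: a + (h *: b + y)) - f (h *: b + y))).
    by apply/funext => t; rewrite addrCA.
  by apply: DeriveDef; rewrite /derivable /derive /= E//; exact: da.
have dg y : is_derive y a g ('D_a f (h *: b + y) - 'D_a f y).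
  by apply: is_deriveB => //; exact/derivableP.
have [|c ch Ec] := @line_mvt g a _ x h; first by move=> y; case: (dg y).
have [d dh Ed] := line_mvt dba (c *: a + x) h.
exists (d *: b + (c *: a + x)); split.
  rewrite addrA opprD addrCA addrN addr0 normrN.
  rewrite (le_trans (ler_normD _ _))// !normrZ addrC mulrDr.
  by apply: lerD; exact: ler_wpM2r.
rewrite -/(g (h *: a + x)) -/(g x) Ec.
by have [_ ->] := dg (c *: a + x); rewrite Ed mulrA expr2.
Qed.

(** Replaces the double limit in the proof of the Schwarz theorem. *)
Lemma eq_of_close_values f g x (C : R) : 0 <= C ->
    {for x, continuous f} -> {for x, continuous g} ->
    (forall h, h != 0 -> exists y z,
      [/\ `|x - y| <= `|h| * C, `|x - z| <= `|h| * C & f y = g z]) ->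
  f x = g x.
Proof.
move=> C0 cf cg H; apply/eqP; rewrite -subr_eq0 -normr_le0.
apply/ler_addgt0Pl => e e0; rewrite addr0.
have e20 : 0 < e / 2 by rewrite divr_gt0.
have /cvgrPdist_le /(_ _ e20) /nbhs_ballP [d1 /= d10 Hd1] := cf.
have /cvgrPdist_le /(_ _ e20) /nbhs_ballP [d2 /= d20 Hd2] := cg.
have d0 : 0 < Num.min d1 d2 by rewrite lt_min d10.
have C1 : 0 < C + 1 by rewrite ltr_wpDl.
(* Any [h] with [h * C] below both radii would do; the [+ 1] covers [C = 0]. *)
pose h := Num.min d1 d2 / (C + 1) / 2.
have h0 : 0 < h by rewrite !divr_gt0.
have hC : `|h| * C < Num.min d1 d2.
  rewrite gtr0_norm// /h mulrAC ltr_pdivrMr// mulrAC ltr_pdivrMr// -mulrA.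
  by rewrite ltr_pM2l//; lra.
have [y [z [Hy Hz E]]] := H h (lt0r_neq0 h0).
move: hC; rewrite lt_min => /andP[h1 h2].
have K1 : `|f x - f y| <= e / 2.
  by apply: Hd1; rewrite -ball_normE /ball_ /= (le_lt_trans Hy).
have K2 : `|g x - g z| <= e / 2.
  by apply: Hd2; rewrite -ball_normE /ball_ /= (le_lt_trans Hz).
rewrite -(subrKA (f y)) (le_trans (ler_normD _ _))// (splitr e) lerD//.
by rewrite E distrC.
Qed.

(** The second difference of [f] is symmetric in [a] and [b], and it equals [h ^ 2] times a
    value near [x] of either mixed derivative. *)
Lemma derive_schwarz f a b : (forall y, derivable f y a) ->
    (forall y, derivable f y b) ->
    (forall y, derivable ('D_a f) y b) -> (forall y, derivable ('D_b f) y a) ->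
    continuous ('D_b ('D_a f)) -> continuous ('D_a ('D_b f)) ->
  forall x, 'D_b ('D_a f) x = 'D_a ('D_b f) x.
Proof.
move=> da db dba dab cba cab x.
have C0 : 0 <= `|a| + `|b| by exact: addr_ge0.
apply: (@eq_of_close_values ('D_b ('D_a f)) ('D_a ('D_b f)) x _ C0 (cba x) (cab x)).
move=> h h0.
have [y [Hy E1]] := second_difference da dba x h0.
have [z [Hz E2]] := second_difference db dab x h0.
exists y, z; split; [exact: Hy|by rewrite [X in _ * X]addrC; exact: Hz|].
move: E1 E2; rewrite (addrCA (h *: b)).
move: ('D_b ('D_a f) y) ('D_a ('D_b f) z) => p q E1 E2.
apply: (mulfI (expf_neq0 2 h0)); rewrite -E1 -E2; ring.
Qed.

End Lines.

Section SecondDerivativeTest.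
Variable R : realType.

(** If the second derivative were positive, [dg] would be positive just to the right of 0
    and [g] would exceed [g 0] there. *)
Lemma second_derivative_test (g dg : R -> R) (d : R) : 0 < d ->
    (forall s : R, `|s| < d -> is_derive s (1 : R) g (dg s)) ->
    (forall s, `|s| < d -> g s <= g 0) -> derivable dg (0 : R) (1 : R) ->
  dg 0 = 0 /\ 'D_1 dg 0 <= 0.
Proof.
move=> d0 dgd gmax ddg.
have in0 s : s \in `](- d), d[ -> `|s| < d by rewrite in_itv /= ltr_norml.
have dg0 : dg 0 = 0.
  have d00 : is_derive (0 : R) (1 : R) g (dg 0) by apply: dgd; rewrite normr0.
  have : is_derive (0 : R) (1 : R) g 0.
    apply: (@derive1_at_max _ g (- d) d).
    - by rewrite lerNl (le_trans _ (ltW d0))// oppr_le0 ltW.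
    - by move=> t /in0 /dgd [].
    - by rewrite in_itv /= oppr_lt0 d0.
    - by move=> t /in0 /gmax.
  by case: d00 => _ <- [_ ->].
split=> //; rewrite leNgt; apply/negP => pos.
have : h^-1 *: (dg (h *: 1 + 0) - dg 0) @[h --> 0^'] --> 'D_1 dg 0 by exact: ddg.
move=> /cvgrPdist_lt /(_ _ pos) /=.
rewrite near_withinE => /nbhs_ballP [r /= r0 Hr].
pose m := Num.min d r / 2.
have m0 : 0 < m by rewrite divr_gt0// lt_min d0.
have [md mr] : m < d /\ m < r.
  have : m < Num.min d r by rewrite ltr_pdivrMr// mulr2n mulrDr mulr1 ltrDl lt_min d0.
  by rewrite lt_min => /andP.
have dgpos s : 0 < s -> s < r -> 0 < dg s.
  move=> s0 sr; have := Hr s; rewrite -ball_normE /ball_ /= sub0r normrN gtr0_norm//.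
  move=> /(_ sr); rewrite gt_eqF// => /(_ isT).
  rewrite addr0 [s *: 1]mulr1 dg0 subr0 => /ltr_normlW.
  by rewrite ltrBlDr ltrDl [s^-1 *: _]mulrC pmulr_lgt0// invr_gt0.
have [||c] := @MVT _ g dg 0 m m0.
- move=> s; rewrite in_itv /= => /andP[s0 sm]; apply: dgd.
  by rewrite gtr0_norm// (lt_trans sm).
- apply: derivable_within_continuous => s; rewrite in_itv /= => /andP[s0 sm].
  have : `|s| < d by rewrite ger0_norm// (le_lt_trans sm).
  by move=> /dgd [].
rewrite in_itv /= => /andP[c0 cm] E.
have /gmax : `|m| < d by rewrite gtr0_norm.
rewrite -subr_le0 E leNgt => /negP; apply.
by rewrite subr0 mulr_gt0// dgpos// (lt_trans cm).
Qed.

End SecondDerivativeTest.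

(** * A class of smooth functions *)

Section DirComp.
Variables (R : realType) (V : normedModType R).

(** The chain rule and the derivatives of coordinates are read off from one variable. *)
Lemma is_derive_from_line (f : V -> R) (x v : V) (d : R) :
  is_derive (0 : R) (1 : R) (fun t : R => f (t *: v + x)) d -> is_derive x v f d.
Proof.
move=> [dl <-]; apply: DeriveDef; first exact/derivable1P.
rewrite /derive /=; congr (lim (_ @ 0^')); apply/funext => h /=.
by rewrite addr0 scale0r add0r [h *: 1]mulr1.
Qed.

Lemma is_derive_comp1 (phi : R -> R) (f : V -> R) (x v : V) (a b : R) :
  is_derive (f x) (1 : R) phi a -> is_derive x v f b ->
  is_derive x v (fun y => phi (f y)) (a * b).
Proof.
move=> dphi [df <-]; apply: is_derive_from_line.
have E : 0 *: v + x = x by rewrite scale0r add0r.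
apply: (@is_derive1_comp _ phi (fun t : R => f (t *: v + x)) 0 a ('D_v f x)).
  by rewrite E.
by have := @is_derive_line _ _ f x v 0; rewrite E; apply.
Qed.

End DirComp.

Section Smooth.
Variables (R : realType) (N : nat).
Local Notation V := 'cV[R]_N.
Implicit Types (f g : V -> R) (x y v : V) (i : 'I_N).

Lemma smooth_continuous f : smooth f -> continuous f.
Proof. by move=> /(_ [::]) []. Qed.

Lemma smooth_derivable_partial f i x : smooth f -> derivable f x (delta_mx i ord0).
Proof. by move=> /(_ [::]) [_]. Qed.

Lemma smooth_partial f i : smooth f -> smooth (partial i f).
Proof. by move=> fs s; have := fs (rcons s i); rewrite foldr_rcons. Qed.

(** Smoothness involves all orders at once, so its stability under products, inverses and
    logarithms is proved for the whole closure under these operations, which partial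
    differentiation preserves. *)
Inductive constructible : (V -> R) -> Prop :=
| Csmooth f : smooth f -> constructible f
| Ccst c : constructible (fun=> c)
| Ccoord k : constructible (fun x => x k ord0)
| Cadd f g : constructible f -> constructible g -> constructible (fun x => f x + g x)
| Cmul f g : constructible f -> constructible g -> constructible (fun x => f x * g x)
| Cinv f : constructible f -> (forall x, f x != 0) -> constructible (fun x => (f x)^-1)
| Cln f : constructible f -> (forall x, 0 < f x) -> constructible (fun x => ln (f x)).

Lemma is_derive_coord k x v : is_derive x v (fun y : V => y k ord0) (v k ord0).
Proof.
apply: is_derive_from_line.
rewrite (_ : (fun _ => _) = (v k ord0 *: @id R) + cst (x k ord0)); last first.
  by apply/funext => t; rewrite !mxE mulrC.
have : is_derive (0 : R) (1 : R) (v k ord0 *: @id R + cst (x k ord0))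
    (v k ord0 *: (1 : R) + 0).
  by apply: is_deriveD.
by rewrite addr0 [_ *: 1]mulr1.
Qed.

Lemma constructible_step f : constructible f -> continuous f /\
  forall i, (forall x, derivable f x (delta_mx i ord0)) /\ constructible (partial i f).
Proof.
elim=> {f}.
- move=> f fs; split; first exact: smooth_continuous.
  move=> i; split; first by move=> x; exact: smooth_derivable_partial.
  by apply: Csmooth; exact: smooth_partial.
- move=> c; split; first by move=> x; exact: cst_continuous.
  move=> i; split; first by move=> x; exact: derivable_cst.
  rewrite (_ : partial i _ = fun=> 0); first exact: Ccst.
  by apply/funext => x; exact: derive_cst.
- move=> k; split; first exact: coord_continuous.
  move=> i; split; first by move=> x; case: (is_derive_coord k x (delta_mx i ord0)).
  rewrite (_ : partial i _ = fun=> (delta_mx i ord0 : V) k ord0); first exact: Ccst.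
  by apply/funext => x; case: (is_derive_coord k x (delta_mx i ord0)).
- move=> f g Cf [cf df] Cg [cg dg]; split.
    by move=> x; exact: (cvgD (cf x) (cg x)).
  move=> i; have [dfi Cfi] := df i; have [dgi Cgi] := dg i; split.
    by move=> x; exact: derivableD.
  rewrite (_ : partial i _ = fun x => partial i f x + partial i g x); first exact: Cadd.
  by apply/funext => x; exact: deriveD.
- move=> f g Cf [cf df] Cg [cg dg]; split.
    by move=> x; exact: (cvgM (cf x) (cg x)).
  move=> i; have [dfi Cfi] := df i; have [dgi Cgi] := dg i; split.
    by move=> x; exact: derivableM.
  rewrite (_ : partial i _ = fun x => f x * partial i g x + g x * partial i f x).
    by apply: Cadd; exact: Cmul.
  by apply/funext => x; exact: deriveM.
- move=> f Cf [cf df] f0; split.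
    by move=> x; exact: (cvgV (f0 x) (cf x)).
  move=> i; have [dfi Cfi] := df i; split.
    by move=> x; exact: derivableV.
  rewrite (_ : partial i _ = fun x => -1 * ((f x)^-1 * (f x)^-1) * partial i f x).
    apply: Cmul => //; apply: Cmul; first exact: Ccst.
    by apply: Cmul; exact: Cinv.
  apply/funext => x; rewrite /partial deriveV// mulN1r -expr2 exprVn.
  by [].
- move=> f Cf [cf df] f0; split.
    move=> x; apply: continuous_comp; first exact: cf.
    exact: continuous_ln.
  move=> i; have [dfi Cfi] := df i.
  have D x : is_derive x (delta_mx i ord0) (fun y => ln (f y))
               ((f x)^-1 * partial i f x).
    by apply: is_derive_comp1; [exact: is_derive1_ln|exact: derivableP].
  split; first by move=> x; case: (D x).
  rewrite (_ : partial i _ = fun x => (f x)^-1 * partial i f x).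
    by apply: Cmul => //; apply: Cinv => // x; rewrite gt_eqF.
  by apply/funext => x; case: (D x).
Qed.

Lemma constructible_smooth f : constructible f -> smooth f.
Proof.
move=> Cf s.
have : constructible (foldr (@partial R N) f s).
  by elim: s => //= i s /constructible_step [_ /(_ i) []].
by move=> /constructible_step [cs ds]; split=> // i x; have [] := ds i.
Qed.

End Smooth.

(** * Directional derivatives of smooth functions *)

Section Rules.
Variables (R : realType) (V : normedModType R).
Implicit Types (f g : V -> R) (x v : V) (a b c : R).

Lemma is_derive_mul f g x v a b : is_derive x v f a -> is_derive x v g b ->
  is_derive x v (fun y => f y * g y) (f x * b + g x * a).
Proof. by move=> df dg; exact: is_deriveM. Qed.

Lemma is_derive_add f g x v a b : is_derive x v f a -> is_derive x v g b ->
  is_derive x v (fun y => f y + g y) (a + b).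
Proof. by move=> df dg; exact: is_deriveD. Qed.

Lemma is_derive_fsum n (h : 'I_n -> V -> R) x v (d : 'I_n -> R) :
  (forall i, is_derive x v (h i) (d i)) ->
  is_derive x v (fun y => \sum_(i < n) h i y) (\sum_(i < n) d i).
Proof.
move=> dh; rewrite (_ : (fun y => _) = \sum_(i < n) h i); first exact: is_derive_sum.
by apply/funext => y; rewrite fct_sumE.
Qed.

Lemma is_derive_dirZ f x v a c : is_derive x v f a -> is_derive x (c *: v) f (c * a).
Proof.
move=> [df <-]; apply: is_derive_from_line.
have E : 0 *: v + x = x by rewrite scale0r add0r.
have -> : (fun t : R => f (t *: (c *: v) + x)) =
    (fun t : R => f (t *: v + x)) \o (c *: @id R).
  by apply/funext => t; rewrite scalerA mulrC.
rewrite mulrC; apply: is_derive1_comp.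
  rewrite [(c *: id) 0]mulr0.
  by have := @is_derive_line _ _ f x v 0; rewrite E; apply.
have : is_derive (0 : R) (1 : R) (c *: @id R) (c *: (1 : R)) by apply: is_deriveZ.
by rewrite [c *: 1]mulr1.
Qed.

End Rules.

Section SmoothCalculus.
Variables (R : realType) (N : nat).
Local Notation V := 'cV[R]_N.
Implicit Types (f g : V -> R) (x y v w : V) (i : 'I_N).

Lemma dotvC x y : dotv x y = dotv y x.
Proof. by apply: eq_bigr => i _; rewrite mulrC. Qed.

Lemma dotvDl x y v : dotv (x + y) v = dotv x v + dotv y v.
Proof. by rewrite -big_split; apply: eq_bigr => i _; rewrite mxE mulrDl. Qed.

Lemma dotvZl c x y : dotv (c *: x) y = c * dotv x y.
Proof. by rewrite /dotv mulr_sumr; apply: eq_bigr => i _; rewrite mxE mulrA. Qed.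

Lemma dotvZr c x y : dotv x (c *: y) = c * dotv x y.
Proof. by rewrite dotvC dotvZl dotvC. Qed.

Lemma dotv_ge0 x : 0 <= dotv x x.
Proof. by apply: sumr_ge0 => i _; rewrite -expr2 sqr_ge0. Qed.

Lemma dotv_delta i x : dotv (delta_mx i ord0) x = x i ord0.
Proof.
rewrite /dotv (bigD1 i)//= big1 => [|j ji]; rewrite !mxE !eqxx/=; first by rewrite mul1r addr0.
by rewrite (negbTE ji) mul0r.
Qed.

Lemma gradE f x i : grad f x i ord0 = partial i f x.
Proof. by rewrite mxE. Qed.

(** A direction is a combination of basis vectors, and the partial derivatives are
    continuous, so [derive_dirD] applies one coordinate at a time. *)
Lemma smooth_is_derive f x v : smooth f -> is_derive x v f (dotv v (grad f x)).
Proof.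
move=> fs.
have step (s : seq 'I_N) : let w := \sum_(i <- s) v i ord0 *: delta_mx i ord0 in
    forall y, is_derive y w f (\sum_(i <- s) v i ord0 * partial i f y).
  elim: s => [|i s IH] w y; first by rewrite /w !big_nil; exact: is_derive0.
  rewrite /w !big_cons.
  have Dw z : 'D_(\sum_(i <- s) v i ord0 *: delta_mx i ord0) f z =
      \sum_(i <- s) v i ord0 * partial i f z by have [_ ->] := IH z.
  have Di z : is_derive z (v i ord0 *: delta_mx i ord0) f (v i ord0 * partial i f z).
    apply: is_derive_dirZ; apply: DeriveDef => //.
    exact: smooth_derivable_partial.
  rewrite -Dw -[v i ord0 * _](@derive_val _ _ _ _ _ _ _ (Di y)).
  apply: derive_dirD.
  - by move=> z; case: (Di z).
  - by move=> z; case: (IH z).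
  - rewrite (funext Dw) => z; elim: (s) => [|j r IHr].
      by under eq_fun do rewrite big_nil; exact: cst_continuous.
    under eq_fun do rewrite big_cons.
    apply: (cvgD _ IHr); apply: cvgM; first exact: cvg_cst.
    exact/smooth_continuous/smooth_partial.
have := step (index_enum 'I_N) x; rewrite /=.
rewrite (_ : \sum_(i <- index_enum 'I_N) v i ord0 *: delta_mx i ord0 = v).
  rewrite (_ : \sum_(i <- index_enum 'I_N) _ = dotv v (grad f x)) //.
  by apply: eq_bigr => i _; rewrite !mxE.
apply/matrixP => k j; rewrite summxE (bigD1 k)//= big1 => [|i ik]; rewrite !mxE.
  by rewrite (ord1 j) !eqxx mulr1 addr0.
by rewrite eq_sym (negbTE ik) mulr0.
Qed.

Lemma smooth_derivable f x v : smooth f -> derivable f x v.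
Proof. by move=> fs; case: (smooth_is_derive x v fs). Qed.

Lemma smooth_deriveE f x v : smooth f -> 'D_v f x = dotv v (grad f x).
Proof. by move=> fs; case: (smooth_is_derive x v fs). Qed.

Lemma constructible_sum n (h : 'I_n -> V -> R) :
  (forall k, constructible (h k)) -> constructible (fun x => \sum_k h k x).
Proof.
move=> Ch; rewrite (_ : (fun x => _) = fun x => \sum_(i <- index_enum 'I_n) h i x)//.
elim: (index_enum _) => [|i s IH].
  by under eq_fun do rewrite big_nil; exact: Ccst.
by under eq_fun do rewrite big_cons; exact: Cadd.
Qed.

Lemma smooth_derive f v : smooth f -> smooth ('D_v f).
Proof.
move=> fs; rewrite (_ : 'D_v f = fun x => \sum_i v i ord0 * partial i f x).
  apply: constructible_smooth; apply: constructible_sum => i.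
  by apply: Cmul; [exact: Ccst|apply: Csmooth; exact: smooth_partial].
by apply/funext => x; rewrite smooth_deriveE//; apply: eq_bigr => i _; rewrite mxE.
Qed.

Lemma smooth_deriveC f v w : smooth f -> 'D_v ('D_w f) = 'D_w ('D_v f).
Proof.
move=> fs; have fw := smooth_derive w fs; have fv := smooth_derive v fs.
have fvw := smooth_continuous (smooth_derive v fw).
have fwv := smooth_continuous (smooth_derive w fv).
have D g u : smooth g -> forall y, derivable g y u by move=> gs y; exact: smooth_derivable.
apply/funext => x.
exact: (derive_schwarz (D _ w fs) (D _ v fs) (D _ v fw) (D _ w fv) fvw fwv).
Qed.

Lemma smooth_derive_partial f v i : smooth f -> 'D_v (partial i f) = partial i ('D_v f).
Proof. exact: smooth_deriveC. Qed.

Lemma is_derive_grad f v x i : smooth f ->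
  is_derive x v (fun y => grad f y i ord0) (grad ('D_v f) x i ord0).
Proof.
move=> fs; rewrite gradE (_ : (fun y => _) = partial i f); last first.
  by apply/funext => y; rewrite gradE.
by rewrite -smooth_derive_partial//; apply/derivableP/smooth_derivable/smooth_partial.
Qed.

Lemma derive_dot_grad f g v x : smooth f -> smooth g ->
  is_derive x v (fun y => dotv (grad f y) (grad g y))
    (dotv (grad ('D_v f) x) (grad g x) + dotv (grad f x) (grad ('D_v g) x)).
Proof.
move=> fs gs; rewrite addrC [X in _ + X]dotvC /dotv -big_split /=.
apply: is_derive_fsum => i.
exact: is_derive_mul (is_derive_grad v x i fs) (is_derive_grad v x i gs).
Qed.

(** [L0 B] has coefficients linear in [x], so differentiating it leaves only the first-order
    term of the drift [B v]. *)
Lemma derive_L0 (B : 'M[R]_N) g v x : smooth g ->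
  is_derive x v (L0 B g) (L0 B ('D_v g) x + dotv (B *m v) (grad g x)).
Proof.
move=> gs; rewrite /L0 -addrA; apply: is_derive_add.
  apply: is_derive_fsum => i.
  have E : partial i (partial i ('D_v g)) = 'D_v (partial i (partial i g)).
    exact: esym (etrans (smooth_derive_partial v i (smooth_partial i gs))
                        (congr1 (partial i) (smooth_derive_partial v i gs))).
  by rewrite E; apply: derivableP; apply: smooth_derivable; do 2!apply: smooth_partial.
rewrite [X in _ + X]dotvC /dotv -big_split /=; apply: is_derive_fsum => i.
apply: is_derive_mul (is_derive_grad v x i gs).
rewrite mxE (_ : (fun y => _) = fun y => \sum_j B i j * y j ord0); last first.
  by apply/funext => y; rewrite mxE.
apply: is_derive_fsum => j.
rewrite -[B i j * v j _]addr0 -[0](mulr0 (x j ord0)).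
by apply: is_derive_mul; exact: is_derive_coord.
Qed.

End SmoothCalculus.

(** * The maximum principle with a cutoff *)

(** At a critical point of [F p ^ 2] one has [p A = - 2 F P]; substituting this in the second
    order condition eliminates the derivatives of [F]. *)
Lemma touching_algebra (R : realType) (p P P2 F A A2 b : R) : 0 < p ->
    F * (p * P + p * P) + p * p * A = 0 ->
    F * ((p * P2 + P * P) + (p * P2 + P * P)) + (p * P + p * P) * A
      + (p * p * A2 + A * (p * P + p * P)) <= 0 ->
  p ^+ 2 * (A2 + b * A) <= F * (6 * (P * P) - 2 * p * (P2 + b * P)).
Proof.
move=> p0 E1 E2.
have E : p * A = - 2 * F * P by apply: (mulfI (lt0r_neq0 p0)); lra.
have E3 : P * (p * A) = P * (- 2 * F * P) by rewrite E.
have -> : p ^+ 2 * (A2 + b * A) = p * p * A2 + p * b * (p * A) by ring.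
rewrite E; lra.
Qed.

(** Second-order operators are compared coordinate by coordinate. *)
Lemma laplacian_drift_sum (R : realType) (N : nat) (g : 'cV[R]_N -> R) (x b : 'cV[R]_N) :
  laplacian g x + dotv b (grad g x) =
  \sum_i (partial i (partial i g) x + b i ord0 * partial i g x).
Proof. by rewrite big_split; congr (_ + _); apply: eq_bigr => i _; rewrite gradE. Qed.

Section MaximumPrinciple.
Variables (R : realType) (N : nat).
Local Notation V := 'cV[R]_N.
Implicit Types (F G phi : V -> R) (x y : V) (i : 'I_N).

Lemma is_derive_partial F i x : smooth F -> is_derive x (delta_mx i ord0) F (partial i F x).
Proof. by move=> Fs; apply/derivableP/smooth_derivable. Qed.

Lemma partialE F i x a : is_derive x (delta_mx i ord0) F a -> partial i F x = a.
Proof. by move=> [_ <-]. Qed.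

Lemma partial_at_local_max G x i : smooth G ->
    (\forall y \near x, G y <= G x) ->
  partial i G x = 0 /\ partial i (partial i G) x <= 0.
Proof.
move=> Gs /nbhs_ballP [d /= d0 Hd].
pose e : V := delta_mx i ord0.
pose r := d / (`|e| + 1).
have e1 : 0 < `|e| + 1 by rewrite ltr_wpDl.
have r0 : 0 < r by rewrite divr_gt0.
pose g (s : R) := G (s *: e + x); pose dg (s : R) := partial i G (s *: e + x).
have D (F : V -> R) (s : R) : smooth F ->
    is_derive s (1 : R) (fun t : R => F (t *: e + x)) (partial i F (s *: e + x)).
  by move=> Fs; apply: is_derive_line; exact: smooth_derivable.
have := @second_derivative_test _ g dg r r0.
have D2 := D _ 0 (smooth_partial i Gs).
have E : (0 : R) *: e + x = x by rewrite scale0r add0r.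
case=> [s _|s sr||dg0 ddg0].
- exact: D.
- rewrite /g E; apply: Hd; rewrite -ball_normE /ball_ /=.
  rewrite opprD addrCA addrN addr0 normrN normrZ.
  rewrite ltr_pdivlMr// in sr; apply: le_lt_trans sr.
  by rewrite ler_wpM2l// lerDl.
- by case: D2.
split; first by move: dg0; rewrite /dg E.
by move: ddg0; case: D2 => _ ->; rewrite E.
Qed.

(** The operator is bounded at a maximum of [F phi ^ 2] by derivatives of the cutoff alone.
    The drift [b] is arbitrary because gradients are determined at a critical point. *)
Lemma max_principle F phi x (b : V) : smooth F -> smooth phi -> 0 < phi x ->
    (\forall y \near x, F y * phi y ^+ 2 <= F x * phi x ^+ 2) ->
  phi x ^+ 2 * (laplacian F x + dotv b (grad F x)) <=
  F x * (6 * dotv (grad phi x) (grad phi x)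
         - 2 * phi x * (laplacian phi x + dotv b (grad phi x))).
Proof.
move=> Fs ps p0 xmax.
pose G y := F y * (phi y * phi y).
have Gs : smooth G.
  by apply: constructible_smooth; apply: Cmul; [|apply: Cmul]; exact: Csmooth.
have Gmax : \forall y \near x, G y <= G x.
  by apply: filterS xmax => y; rewrite /G -!expr2.
have dG i y : is_derive y (delta_mx i ord0) G
    (F y * (phi y * partial i phi y + phi y * partial i phi y)
     + phi y * phi y * partial i F y).
  by do 2?apply: is_derive_mul; exact: is_derive_partial.
pose A i := partial i F x; pose P i := partial i phi x.
pose A2 i := partial i (partial i F) x; pose P2 i := partial i (partial i phi) x.
have ddG i : partial i (partial i G) x =
    F x * ((phi x * P2 i + P i * P i) + (phi x * P2 i + P i * P i))
    + (phi x * P i + phi x * P i) * A i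
    + (phi x * phi x * A2 i + A i * (phi x * P i + phi x * P i)).
  rewrite (_ : partial i G = fun y => F y * (phi y * partial i phi y + phi y * partial i phi y)
     + phi y * phi y * partial i F y); last by apply/funext => y; exact: partialE.
  have dF := is_derive_partial i x Fs.
  have dp := is_derive_partial i x ps.
  have ddF := is_derive_partial i x (smooth_partial i Fs).
  have ddp := is_derive_partial i x (smooth_partial i ps).
  have dpp := is_derive_mul dp ddp.
  exact: partialE (is_derive_add (is_derive_mul dF (is_derive_add dpp dpp))
                         (is_derive_mul (is_derive_mul dp dp) ddF)).
have H i : phi x ^+ 2 * (A2 i + b i ord0 * A i) <=
  F x * (6 * (P i * P i) - 2 * phi x * (P2 i + b i ord0 * P i)).
  have [G1 G2] := partial_at_local_max i Gs Gmax.
  apply: touching_algebra => //; last by rewrite -ddG.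
  by rewrite -[LHS](partialE (dG i x)).
rewrite [X in _ * X <= _]laplacian_drift_sum [X in _ - _ * X]laplacian_drift_sum.
rewrite [in leRHS]/dotv !mulr_sumr -sumrB mulr_sumr.
by apply: ler_sum => i _; rewrite !gradE; exact: H.
Qed.

End MaximumPrinciple.

(** * Equations satisfied by the logarithm of a positive solution *)

Lemma is_derive_unique (R : realType) (V : normedModType R) (f g : V -> R) x v a b :
  f =1 g -> is_derive x v f a -> is_derive x v g b -> a = b.
Proof. by move=> /funext -> [_ <-] [_ <-]. Qed.

Lemma laplacian_sum_squares (R : realType) (N n : nat) (g : 'I_n -> 'cV[R]_N -> R)
    (q : 'cV[R]_N -> R) (x b : 'cV[R]_N) :
  (forall k, smooth (g k)) -> (forall y, q y = \sum_k g k y * g k y) ->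
  laplacian q x + dotv b (grad q x) =
  \sum_k (2 * (g k x * (laplacian (g k) x + dotv b (grad (g k) x)))
   + 2 * dotv (grad (g k) x) (grad (g k) x)).
Proof.
move=> gs /funext qE.
have dg k i y := is_derive_partial i y (gs k).
have ddg k i y := is_derive_partial i y (smooth_partial i (gs k)).
have dq i y : partial i q y = \sum_k (g k y * partial i (g k) y + g k y * partial i (g k) y).
  by rewrite qE; apply: partialE; apply: is_derive_fsum => k; exact: is_derive_mul.
have ddq i : partial i (partial i q) x = \sum_k
   ((g k x * partial i (partial i (g k)) x + partial i (g k) x * partial i (g k) x)
  + (g k x * partial i (partial i (g k)) x + partial i (g k) x * partial i (g k) x)).
  rewrite (funext (dq i)); apply: partialE; exact: is_derive_fsum.
rewrite [LHS]laplacian_drift_sum.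
transitivity (\sum_i \sum_k
  (2 * (g k x * (partial i (partial i (g k)) x + b i ord0 * partial i (g k) x))
  + 2 * (partial i (g k) x * partial i (g k) x))).
  apply: eq_bigr => i _; rewrite dq ddq mulr_sumr -big_split /=; apply: eq_bigr => k _.
  by move: (g k x) (partial i (g k) x) (partial i (partial i (g k)) x) => p1 p2 p3; ring.
rewrite exchange_big /=; apply: eq_bigr => k _.
rewrite big_split /= -!mulr_sumr laplacian_drift_sum; congr (_ + 2 * _).
by apply: eq_bigr => i _; rewrite gradE.
Qed.

Section Identities.
Variables (R : realType) (N : nat) (B : 'M[R]_N).
Local Notation V := 'cV[R]_N.
Implicit Types (f g u : V -> R) (x y v : V) (i : 'I_N).

Lemma smooth_ln u : smooth u -> (forall x, 0 < u x) -> smooth (fun x => ln (u x)).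
Proof. by move=> us u0; apply: constructible_smooth; apply: Cln => //; exact: Csmooth. Qed.

Lemma is_derive_ln_comp u x v a : 0 < u x -> is_derive x v u a ->
  is_derive x v (fun y => ln (u y)) ((u x)^-1 * a).
Proof. by move=> u0 du; apply: is_derive_comp1; exact: is_derive1_ln. Qed.

Lemma is_derive_inv_comp u x v a : u x != 0 -> is_derive x v u a ->
  is_derive x v (fun y => (u y)^-1) (- (u x) ^- 2 * a).
Proof.
by move=> u0 [du <-]; apply: DeriveDef; [exact: derivableV|exact: deriveV].
Qed.

Lemma derive_derive_ln u x v : smooth u -> (forall y, 0 < u y) ->
  'D_v ('D_v (fun y => ln (u y))) x =
  (u x)^-1 * 'D_v ('D_v u) x + 'D_v u x * (- (u x) ^- 2 * 'D_v u x).
Proof.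
move=> us u0.
have du y : is_derive y v u ('D_v u y) by apply/derivableP/smooth_derivable.
rewrite (_ : 'D_v (fun y => ln (u y)) = fun y => (u y)^-1 * 'D_v u y); last first.
  by apply/funext => y; case: (is_derive_ln_comp (u0 y) (du y)).
have ddu : is_derive x v ('D_v u) ('D_v ('D_v u) x).
  by apply/derivableP/smooth_derivable/smooth_derive.
by case: (is_derive_mul (is_derive_inv_comp (lt0r_neq0 (u0 x)) (du x)) ddu).
Qed.

(** The quadratic term compensates the square of the gradient that the second derivative of
    the logarithm produces. *)
Lemma log_equation u x : smooth u -> (forall y, 0 < u y) -> L0 B u x = 0 ->
  let f := fun y => ln (u y) in L0 B f x + dotv (grad f x) (grad f x) = 0.
Proof.
move=> us u0 Lu f.
have df i : partial i f x = (u x)^-1 * partial i u x.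
  exact: partialE (is_derive_ln_comp (u0 x) (is_derive_partial i x us)).
have -> : L0 B f x + dotv (grad f x) (grad f x) = (u x)^-1 * L0 B u x; last first.
  by rewrite Lu mulr0.
rewrite /L0 addrAC mulrDr; congr (_ + _).
  rewrite /laplacian /dotv mulr_sumr -big_split /=; apply: eq_bigr => i _.
  rewrite !gradE df /partial derive_derive_ln//.
  rewrite -exprVn; move: (derive _ _ _) (derive _ _ _) (u x)^-1 => p2 p1 w; ring.
rewrite /dotv mulr_sumr; apply: eq_bigr => i _.
by rewrite !gradE df mulrCA.
Qed.

Variable f : V -> R.
Hypothesis fs : smooth f.
Hypothesis feq : forall x, L0 B f x + dotv (grad f x) (grad f x) = 0.

Lemma derive_log_equation v x :
  L0 B ('D_v f) x + dotv (B *m v) (grad f x)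
    + 2 * dotv (grad f x) (grad ('D_v f) x) = 0.
Proof.
have D := is_derive_add (derive_L0 B v x fs) (derive_dot_grad v x fs fs).
have := is_derive_unique feq D (is_derive_cst 0 x v).
rewrite (dotvC (grad ('D_v f) x)).
move: (L0 _ _ _) (dotv _ _) (dotv _ _) => p1 p2 p3 H; lra.
Qed.

Lemma is_derive_dot_cst g v w x : smooth g ->
  is_derive x v (fun y => dotv w (grad g y)) (dotv w (grad ('D_v g) x)).
Proof.
move=> gs; apply: is_derive_fsum => i.
rewrite -[w i ord0 * _]addr0 -[X in _ + X](mulr0 (grad g x i ord0)).
by apply: is_derive_mul; exact: is_derive_grad.
Qed.

(** The equation of [f] differentiated twice along [v]. The term [dotv (B *m v) (grad fv x)],
    which has no sign, is the one that the invariance of the compact set of directions removes. *)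
Lemma hessian_equation v x fv h : fv = 'D_v f -> h = 'D_v fv ->
  L0 B h x + 2 * dotv (B *m v) (grad fv x) + 2 * dotv (grad fv x) (grad fv x)
    + 2 * dotv (grad f x) (grad h x) = 0.
Proof.
move=> Ef Eh; have fvs : smooth fv by rewrite Ef; exact: smooth_derive.
have D1 : is_derive x v (L0 B fv) (L0 B h x + dotv (B *m v) (grad fv x)).
  by rewrite Eh; exact: derive_L0.
have D2 : is_derive x v (fun y => dotv (B *m v) (grad f y)) (dotv (B *m v) (grad fv x)).
  by rewrite Ef; exact: is_derive_dot_cst.
have D3 : is_derive x v (fun y => dotv (grad f y) (grad fv y))
   (dotv (grad fv x) (grad fv x) + dotv (grad f x) (grad h x)).
  have E : grad ('D_v f) x = grad fv x by rewrite Ef.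
  by rewrite Eh -{1}E; exact: derive_dot_grad.
have D4 := is_derive_mul (is_derive_cst (2 : R) x v) D3.
have Z y : L0 B fv y + dotv (B *m v) (grad f y) + 2 * dotv (grad f y) (grad fv y) = 0.
  by rewrite Ef; exact: derive_log_equation.
have := is_derive_unique Z (is_derive_add (is_derive_add D1 D2) D4) (is_derive_cst 0 x v).
rewrite mulr0 addr0.
move: (L0 _ _ _) (dotv _ _) (dotv _ _) (dotv _ _) => p1 p2 p3 p4 H; lra.
Qed.

(** Gives the linearised equation the shape of the operator in [max_principle]. *)
Lemma drift_form g x : L0 B g x + 2 * dotv (grad f x) (grad g x) =
  laplacian g x + dotv (B *m x + 2 *: grad f x) (grad g x).
Proof. by rewrite dotvDl dotvZl addrA. Qed.

(** A Bochner formula: the equations of the partial derivatives are multiplied by these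
    derivatives and added up. *)
Lemma gradient_equation x q : (forall y, q y = dotv (grad f y) (grad f y)) ->
  laplacian q x + dotv (B *m x + 2 *: grad f x) (grad q x) =
  2 * (\sum_i dotv (grad (partial i f) x) (grad (partial i f) x))
   - 2 * dotv (B *m grad f x) (grad f x).
Proof.
move=> qE; set b := B *m x + _.
have {}qE y : q y = \sum_k partial k f y * partial k f y.
  by rewrite qE; apply: eq_bigr => k _; rewrite gradE.
rewrite (laplacian_sum_squares x b (fun k => smooth_partial k fs) qE).
have H k : laplacian (partial k f) x + dotv b (grad (partial k f) x)
    = - dotv (B *m delta_mx k ord0) (grad f x).
  have := derive_log_equation (delta_mx k ord0) x.
  by rewrite addrAC drift_form => /eqP; rewrite addr_eq0 => /eqP.
have -> : dotv (B *m grad f x) (grad f x) =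
    \sum_k partial k f x * dotv (B *m delta_mx k ord0) (grad f x).
  rewrite /dotv; under eq_bigr do rewrite mxE mulr_suml.
  rewrite exchange_big /=; apply: eq_bigr => k _; rewrite mulr_sumr; apply: eq_bigr => i _.
  by rewrite -colE !gradE [col _ _ _ _]mxE mulrCA mulrA.
rewrite !mulr_sumr -sumrB; apply: eq_bigr => k _; rewrite H.
by move: (partial k f x) (dotv _ _) (dotv _ _) => p1 p2 p3; ring.
Qed.

End Identities.

(** * The inner product, compactness and weighted maxima *)

Section Compactness.
Variables (R : realType) (N : nat).
Local Notation V := 'cV[R]_N.
Implicit Types (x y : V) (phi : V -> R).

(** Expand the square of [dotv y y *: x - dotv x y *: y]. *)
Lemma dotv_Cauchy_Schwarz x y : dotv x y ^+ 2 <= dotv x x * dotv y y.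
Proof.
have [y0|] := eqVneq (dotv y y) 0.
  have yi i : y i ord0 = 0.
    apply/eqP; rewrite -sqrf_eq0 eq_le sqr_ge0 andbT -y0 /dotv (bigD1 i)//= -expr2 lerDl.
    by apply: sumr_ge0 => j _; rewrite -expr2 sqr_ge0.
  rewrite y0 mulr0 /dotv big1 ?expr0n// => i _.
  by rewrite yi mulr0.
move=> y0; have y1 : 0 < dotv y y by rewrite lt_def y0 dotv_ge0.
have H : dotv (dotv y y *: x + - dotv x y *: y) (dotv y y *: x + - dotv x y *: y)
   = dotv y y * (dotv x x * dotv y y - dotv x y ^+ 2).
  rewrite !dotvDl !dotvZl !(dotvC _ (_ + _)) !dotvDl !dotvZl (dotvC y x).
  by move: (dotv x y) (dotv x x) (dotv y y) => p1 p2 p3; ring.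
by move: (dotv_ge0 (dotv y y *: x + - dotv x y *: y)); rewrite H pmulr_rge0// subr_ge0.
Qed.

Lemma sum_sqr_le (a : 'I_N -> R) : (\sum_i a i) ^+ 2 <= N%:R * \sum_i a i ^+ 2.
Proof.
have := dotv_Cauchy_Schwarz (\col_i (1 : R)) (\col_i a i).
rewrite /dotv.
under eq_bigr do rewrite !mxE mul1r.
under [X in _ <= X * _]eq_bigr do rewrite !mxE mul1r.
under [X in _ <= _ * X]eq_bigr do rewrite !mxE -expr2.
by rewrite sumr_const card_ord.
Qed.

Lemma dotv_le_half c x y : 0 < c -> 2 * dotv x y <= c * dotv x x + c^-1 * dotv y y.
Proof.
move=> c0.
have := dotv_ge0 (c *: x + (-1) *: y).
rewrite !dotvDl !dotvZl !(dotvC _ (_ + _)) !dotvDl !dotvZl (dotvC y x).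
move: (dotv x y) (dotv x x) (dotv y y) => p1 p2 p3 H.
rewrite -(ler_pM2l c0) mulrDr mulrA mulrA [c * (c^-1 * _)]mulrA divff ?gt_eqF// mul1r.
lra.
Qed.

Lemma dotv_add_le x y : dotv (x + y) (x + y) <= 2 * dotv x x + 2 * dotv y y.
Proof.
have := dotv_ge0 (x + (-1) *: y).
rewrite !dotvDl !dotvZl !(dotvC _ (_ + _)) !dotvDl !dotvZl (dotvC y x).
by move: (dotv x y) (dotv x x) (dotv y y) => p1 p2 p3; lra.
Qed.

(** The form in which the growth of the drift enters the estimate with the logarithmic cutoff. *)
Lemma dotv_drift_le (u g x : V) (b c : R) : 0 <= b ->
    dotv u u <= b * dotv x x -> dotv g g <= c * (1 + dotv x x) ->
  2 * dotv (u + 2 *: g) x <= (2 * b + 8 * c + 1) * (1 + dotv x x).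
Proof.
move=> b0 Hu Hg.
have := dotv_le_half (u + 2 *: g) x ltr01; rewrite invr1.
have := dotv_add_le u (2 *: g); rewrite dotvZl dotvZr.
move: Hu Hg (dotv_ge0 x); set v := u + _.
move: (dotv u u) (dotv g g) (dotv x x) (dotv v v) (dotv v x) => p1 p2 p3 p4 p5; nra.
Qed.

Lemma coord_sqr_le x i : x i ord0 ^+ 2 <= dotv x x.
Proof.
rewrite /dotv (bigD1 i)//= -expr2 lerDl.
by apply: sumr_ge0 => j _; rewrite -expr2 sqr_ge0.
Qed.

Lemma mulmx_dotv_bound (B : 'M[R]_N) :
  exists2 b, 0 <= b & forall x, dotv (B *m x) (B *m x) <= b * dotv x x.
Proof.
exists (\sum_i dotv (row i B)^T (row i B)^T); first by apply: sumr_ge0 => i _; exact: dotv_ge0.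
move=> x; rewrite {1}/dotv mulr_suml; apply: ler_sum => i _.
rewrite -expr2 (_ : (B *m x) i ord0 = dotv (row i B)^T x); first exact: dotv_Cauchy_Schwarz.
by rewrite mxE; apply: eq_bigr => j _; rewrite !mxE.
Qed.

(** Carries the compactness of bounded closed sets from row vectors to column vectors. *)
Lemma trmx_continuous : continuous (fun u : 'rV[R]_N => u^T).
Proof.
move=> /= u s /= /(nbhs_ballP u^T) [e e0 es].
apply/nbhs_ballP; exists e => //= w [_ uw]; apply: es; split => // i j.
by rewrite !mxE; exact: uw.
Qed.

Lemma dotv_smooth : smooth (fun x : V => dotv x x).
Proof.
by apply/constructible_smooth/constructible_sum => i; apply: Cmul; exact: Ccoord.
Qed.

Lemma bounded_closed_compact_cV (A : set V) r :
  (forall x, A x -> dotv x x <= r) -> closed A -> compact A.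
Proof.
move=> Ar Acl.
have -> : A = (fun u : 'rV[R]_N => u^T) @` [set u | A u^T].
  apply/seteqP; split => [x Ax|_ [u Au <-]] //.
  by exists x^T => /=; rewrite trmxK.
apply: continuous_compact; first by apply: continuous_subspaceT; exact: trmx_continuous.
apply: bounded_closed_compact.
  exists (1 + r); split; first by rewrite num_real.
  move=> M rM u /= Au; rewrite /Num.norm /= mx_normrE.
  apply: bigmax_le => [|[i j] _ /=].
    have : 0 <= r by apply: le_trans (Ar _ Au); exact: dotv_ge0.
    by move: rM; lra.
  have := le_trans (coord_sqr_le u^T j) (Ar _ Au).
  rewrite mxE (ord1 i) -real_normK ?num_real//.
  by move: `|u 0 j| => a Ha; move: rM; nra.
have := closed_comp (f := fun u : 'rV[R]_N => u^T) _ Acl; apply => u _.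
exact: trmx_continuous.
Qed.

Lemma closed_nonneg phi : continuous phi -> closed [set x | 0 <= phi x].
Proof.
move=> cphi; rewrite (_ : [set x | _] = phi @^-1` [set t | 0 <= t]) //.
by apply: closed_comp => [x _|]; [exact: cphi|exact: closed_ge].
Qed.

(** The maximum is taken over directions and points at once, so that it is critical in both. *)
Lemma exists_weighted_max (K : set V) (F : V -> V -> R) phi r xi0 x0 :
    compact K -> continuous (fun p : V * V => F p.1 p.2) -> smooth phi ->
    (forall x, 0 <= phi x -> dotv x x <= r) -> K xi0 -> 0 <= phi x0 ->
  exists xi1 x1, [/\ K xi1, 0 <= phi x1 &
    forall xi x, K xi -> 0 <= phi x -> F xi x * phi x ^+ 2 <= F xi1 x1 * phi x1 ^+ 2].
Proof.
move=> cK cF phis phir Kxi0 phix0.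
have cD : compact [set x | 0 <= phi x].
  apply: (bounded_closed_compact_cV (r := r)) => //.
  exact/closed_nonneg/smooth_continuous.
have [] := @compact_EVT_max _ R (fun p : V * V => F p.1 p.2 * phi p.2 ^+ 2)
    (K `*` [set x | 0 <= phi x]) _ (compact_setX cK cD) _.
- by exists (xi0, x0).
- apply: continuous_subspaceT => p; apply: cvgM; first exact: cF.
  rewrite expr2; under eq_fun do rewrite expr2.
  have c2 : phi q.2 @[q --> p] --> phi p.2.
    apply: (@continuous_comp _ _ _ snd phi); first exact: cvg_snd.
    exact: smooth_continuous.
  exact: cvgM.
move=> [xi1 x1] /= /set_mem [/= K1 p1] H; exists xi1, x1; split=> // xi x Kxi px.
by apply: (H (xi, x)); apply/mem_set.
Qed.

Lemma near_pos phi x : continuous phi -> 0 < phi x -> \forall y \near x, 0 <= phi y.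
Proof.
move=> cphi p0; have /cvgrPdist_lt /(_ _ p0) := cphi x.
apply: filterS => y /ltr_normlW; rewrite ltrBlDr ltrDl => h; exact: ltW.
Qed.

Lemma is_derive_dotv x i : is_derive x (delta_mx i ord0) (fun y : V => dotv y y) (2 * x i ord0).
Proof.
have d k := is_derive_coord k x (delta_mx i ord0).
have D := fun k => is_derive_mul (d k) (d k).
have := is_derive_fsum D.
rewrite (_ : \sum_k _ = 2 * x i ord0) // (bigD1 i)//= big1 => [|k ki]; rewrite !mxE.
  by rewrite !eqxx /=; lra.
by rewrite (negbTE ki) /= mulr0 addr0.
Qed.

End Compactness.

(** * Quadratic growth of the squared gradient *)

Section GradientEstimate.
Variables (R : realType) (N : nat) (B : 'M[R]_N).
Local Notation V := 'cV[R]_N.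
Implicit Types (x y : V).

Definition quadratic_cutoff (r : R) (x : V) := 1 + - r^-1 * dotv x x.

Lemma quadratic_cutoff_smooth r : smooth (quadratic_cutoff r).
Proof.
apply: constructible_smooth; apply: Cadd; first exact: Ccst.
by apply: Cmul; [exact: Ccst|apply: Csmooth; exact: dotv_smooth].
Qed.

Lemma quadratic_cutoff_partial r i x : partial i (quadratic_cutoff r) x = - r^-1 * (2 * x i ord0).
Proof.
rewrite (partialE (is_derive_add (is_derive_cst (1 : R) x _)
  (is_derive_mul (is_derive_cst (- r^-1) x _) (is_derive_dotv x i)))).
by rewrite mulr0 addr0 add0r.
Qed.

Lemma quadratic_cutoff_grad r x : grad (quadratic_cutoff r) x = (- r^-1 * 2) *: x.
Proof.
by apply/matrixP => i j; rewrite (ord1 j) gradE quadratic_cutoff_partial !mxE mulrA.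
Qed.

Lemma quadratic_cutoff_laplacian r x : laplacian (quadratic_cutoff r) x = - r^-1 * 2 * N%:R.
Proof.
rewrite /laplacian (eq_bigr (fun=> - r^-1 * 2)); last first.
  move=> i _; rewrite (funext (quadratic_cutoff_partial r i)).
  rewrite (partialE (is_derive_mul (is_derive_cst (- r^-1) x _)
    (is_derive_mul (is_derive_cst (2 : R) x _) (is_derive_coord i x _)))).
  by rewrite mxE !eqxx /= !mulr0 !addr0 mulr1.
by rewrite sumr_const card_ord [RHS]mulr_natr.
Qed.

Variable f : V -> R.
Hypothesis fs : smooth f.
Hypothesis feq : forall x, L0 B f x + dotv (grad f x) (grad f x) = 0.
Let q x := dotv (grad f x) (grad f x).

Lemma grad_sqr_smooth : smooth q.
Proof.
apply: constructible_smooth; rewrite (_ : q = fun x => \sum_i partial i f x * partial i f x).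
  by apply: constructible_sum => i; apply: Cmul; apply: Csmooth; exact: smooth_partial.
by apply/funext => x; apply: eq_bigr => i _; rewrite gradE.
Qed.

(** The equation expresses the Laplacian of [f] by first-order terms, which gives a lower
    bound for the second derivatives that is quadratic in [q]. *)
Lemma laplacian_sqr_le_hessian x : (q x + dotv (B *m x) (grad f x)) ^+ 2 <=
  N%:R * \sum_i dotv (grad (partial i f) x) (grad (partial i f) x).
Proof.
have -> : (q x + dotv (B *m x) (grad f x)) ^+ 2 = laplacian f x ^+ 2.
  have := feq x; rewrite /L0 -/(q x).
  move: (q x) (laplacian f x) (dotv _ _) => p1 p2 p3 H.
  by rewrite (_ : p2 = - (p1 + p3)) ?sqrrN//; lra.
apply: (le_trans (sum_sqr_le _)); rewrite ler_wpM2l//; apply: ler_sum => i _.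
by apply: le_trans (coord_sqr_le _ i); rewrite gradE.
Qed.

(** The quadratic term [q1 ^ 2] on the left dominates; here [p] is the cutoff, [w] the
    inverse squared radius of its support, [T] the squared norm of the point, and [c], [e], [g] are
    the scalar products brought in by the drift. The hypothesis [2 * bx <= q1] says that the
    gradient dominates [B x]. *)
Lemma weighted_gradient_algebra (n b p w q1 S s bx c T e g : R) :
  0 <= n -> 0 <= b -> 0 < w -> w <= 1 -> 0 < p -> p <= 1 -> 0 < q1 ->
  0 <= T -> w * T <= 1 -> bx <= b * T -> 2 * bx <= q1 ->
  - (2 * s) <= q1 + bx -> 2 * c <= (b + 1) * q1 -> 2 * e <= bx + T ->
  (forall k, 0 < k -> 2 * g <= k * q1 + k^-1 * T) ->
  (q1 + s) ^+ 2 <= n * S ->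
  p ^+ 2 * (2 * S - 2 * c) <=
    q1 * (6 * ((w * 2) ^+ 2 * T) - 2 * p * (- (w * 2 * n) - w * 2 * (e + 2 * g))) ->
  p ^+ 2 * q1 <= 16 * (n + 1) * (3 * (b + 1) + 24 + 4 * n + 256 * (n + 1)).
Proof.
move=> n0 b0 w0 w1 p0 p1 q0 T0 wT bT bq Hs Hc He Hg HS Hmax.
set n1 := n + 1; have n1_gt0 : 0 < n1 by rewrite /n1; lra.
have pw : p * w <= 1 by nra.
have S1 : q1 ^+ 2 <= 16 * n1 * S.
  have sq : q1 ^+ 2 <= 16 * (q1 + s) ^+ 2 by nra.
  have nS : n * S <= n1 * S.
    rewrite /n1 mulrDl mul1r lerDl.
    have : 0 <= n * S by apply: le_trans HS; exact: sqr_ge0.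
    have [//|S0] := leP 0 S.
    have : 0 < q1 + s by lra.
    move=> qs; have : 0 < (q1 + s) ^+ 2 by rewrite exprn_gt0.
    by nra.
  nra.
have K1 : 6 * ((w * 2) ^+ 2 * T) <= 24 by nra.
have K2 : p * w * n <= n by nra.
have K3 : 2 * (p * w * (2 * e)) <= 2 * (b + 1).
  have : 2 * e <= (b + 1) * T by lra.
  move=> He'; have : p * w * (2 * e) <= p * w * ((b + 1) * T).
    by rewrite ler_wpM2l// mulr_ge0// ltW.
  have : p * w * ((b + 1) * T) <= b + 1.
    have pT : p * (w * T) <= 1 by nra.
    rewrite (_ : _ * _ = (b + 1) * (p * (w * T))); last by ring.
    by rewrite ger_pMr//; lra.
  lra.
have K4 : 4 * (p * w * (2 * g)) <= p ^+ 2 * q1 / (16 * n1) + 256 * n1.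
  (* Young's inequality with this weight: the term in [q1] costs half of the coefficient
     [1 / (8 * n1)] available on the left. *)
  pose k := p / (64 * n1 * w).
  have k0 : 0 < k by rewrite divr_gt0// !mulr_gt0.
  have := Hg k k0; move=> Hk.
  have : p * w * (2 * g) <= p * w * (k * q1 + k^-1 * T).
    by rewrite ler_wpM2l// mulr_ge0// ltW.
  rewrite (_ : p * w * (k * q1 + k^-1 * T) =
     p ^+ 2 * q1 / (64 * n1) + 64 * n1 * (w * (w * T))); last first.
    by rewrite /k; field; rewrite !gt_eqF.
  have wwT : w * (w * T) <= 1 by nra.
  have : 64 * n1 * (w * (w * T)) <= 64 * n1 by rewrite ger_pMr// mulr_gt0.
  have -> : p ^+ 2 * q1 / (16 * n1) = 4 * (p ^+ 2 * q1 / (64 * n1)).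
    by field; rewrite gt_eqF.
  lra.
set P := p ^+ 2 * q1 in K4 *.
have H1 : q1 * (P / (8 * n1)) <= p ^+ 2 * (2 * S).
  rewrite (_ : q1 * (P / (8 * n1)) = p ^+ 2 * (q1 ^+ 2 / (8 * n1))); last first.
    by rewrite /P; field; rewrite gt_eqF.
  rewrite ler_wpM2l ?sqr_ge0// ler_pdivrMr ?mulr_gt0//; lra.
have H2 : p ^+ 2 * (2 * c) <= q1 * (b + 1).
  have p2 : p ^+ 2 <= 1 by nra.
  have : p ^+ 2 * (2 * c) <= p ^+ 2 * ((b + 1) * q1) by rewrite ler_wpM2l ?sqr_ge0.
  have : p ^+ 2 * ((b + 1) * q1) <= (b + 1) * q1.
    by rewrite ger_pMl// mulr_gt0//; lra.
  lra.
have H3 : P / (8 * n1) <= b + 1 +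
   (6 * ((w * 2) ^+ 2 * T) - 2 * p * (- (w * 2 * n) - w * 2 * (e + 2 * g))).
  rewrite -(ler_pM2l q0) [X in _ <= X]mulrDr; move: Hmax H1 H2; rewrite [p ^+ 2 * _]mulrBr.
  move: (P / _) (_ - 2 * p * _) => P8 X; move: (p ^+ 2 * _) (p ^+ 2 * _) => p3 p4.
  move: (q1 * P8) (q1 * X) (q1 * _) => y1 y2 y3; lra.
have E8 : P / (8 * n1) = 2 * (P / (16 * n1)) by field; rewrite gt_eqF.
have H4 : P / (16 * n1) <= 3 * (b + 1) + 24 + 4 * n + 256 * n1 by lra.
by move: H4; rewrite ler_pdivrMr ?mulr_gt0// mulrC.
Qed.

(** At a maximum of [q phi ^ 2] either [q] is already controlled by the squared norm of [B x],
    or the Bochner formula bounds [q phi ^ 2] by a constant. *)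
Theorem gradient_growth : exists2 C, 0 <= C &
  forall x, q x <= C * (1 + dotv x x).
Proof.
have [b b0 Bb] := mulmx_dotv_bound B.
pose n : R := N%:R; have n0 : 0 <= n by rewrite /n ler0n.
pose C1 := 16 * (n + 1) * (3 * (b + 1) + 24 + 4 * n + 256 * (n + 1)).
have C10 : 0 <= C1 by apply: mulr_ge0; lra.
have Cr0 r : 0 <= r -> 0 <= (C1 + 2 * b) * r by move=> r0; apply: mulr_ge0 => //; lra.
exists (8 * (C1 + 2 * b)); first by lra.
(* With this radius the cutoff is at least 1/2 at [x]. *)
move=> x; pose r := 2 * (1 + dotv x x).
have x20 := dotv_ge0 x.
have r1 : 1 <= r by rewrite /r; lra.
have r0 : 0 < r by lra.
pose phi := quadratic_cutoff r.
have phis : smooth phi by exact: quadratic_cutoff_smooth.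
have phix : 1 / 2 <= phi x.
  rewrite /phi /quadratic_cutoff mulNr lerBrDr -lerBrDl.
  rewrite [_^-1 * _]mulrC ler_pdivrMr// /r; lra.
have phir y : 0 <= phi y -> dotv y y <= r.
  by rewrite /phi /quadratic_cutoff mulNr subr_ge0 [_^-1 * _]mulrC ler_pdivrMr// mul1r.
have phi1 y : phi y <= 1.
  by rewrite /phi /quadratic_cutoff mulNr gerBl mulr_ge0 ?dotv_ge0// invr_ge0 ltW.
have [||||||_ [x1 [_ p0 xmax]]] := @exists_weighted_max R N [set 0] (fun _ => q) phi r 0 x.
- exact: compact_set1.
- move=> p; apply: (@continuous_comp _ _ _ snd q); first exact: cvg_snd.
  exact/smooth_continuous/grad_sqr_smooth.
- exact: phis.
- exact: phir.
- by [].
- by apply: le_trans phix; rewrite divr_ge0.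
have {}xmax y : 0 <= phi y -> q y * phi y ^+ 2 <= q x1 * phi x1 ^+ 2 by exact: xmax.
suff H : q x1 * phi x1 ^+ 2 <= (C1 + 2 * b) * r.
  have qx : q x * phi x ^+ 2 <= (C1 + 2 * b) * r.
    by apply: le_trans H; apply: xmax; apply: le_trans phix; rewrite divr_ge0.
  have q0 : 0 <= q x by exact: dotv_ge0.
  have : q x * (1 / 4) <= q x * phi x ^+ 2 by rewrite ler_wpM2l//; nra.
  by rewrite /r in qx *; lra.
have q0 : 0 <= q x1 by exact: dotv_ge0.
have T0 := dotv_ge0 x1.
have Tr := phir _ p0.
have [|Lq] := leP (q x1) (2 * dotv (B *m x1) (B *m x1)).
  move=> Hq; have qr : q x1 <= 2 * b * r by have := Bb x1; nra.
  have p2 : phi x1 ^+ 2 <= 1 by have := phi1 x1; nra.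
  have : q x1 * phi x1 ^+ 2 <= q x1 by rewrite ler_piMr.
  by have := mulr_ge0 C10 (ltW r0); lra.
have {}q0 : 0 < q x1.
  by apply: le_lt_trans Lq; rewrite mulr_ge0// dotv_ge0.
move: p0; rewrite le_eqVlt => /orP[/eqP<-|p0].
  by rewrite expr0n mulr0; exact/Cr0/ltW.
suff H : phi x1 ^+ 2 * q x1 <= C1.
  rewrite mulrC; apply: (le_trans H).
  by have := mulr_ge0 b0 (ltW r0); nra.
have near1 : \forall y \near x1, q y * phi y ^+ 2 <= q x1 * phi x1 ^+ 2.
  by apply: filterS (near_pos (smooth_continuous phis) p0) => y; exact: xmax.
have := max_principle (B *m x1 + 2 *: grad f x1) grad_sqr_smooth phis p0 near1.
have qE y : q y = dotv (grad f y) (grad f y) by [].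
rewrite [X in _ * X <= _](gradient_equation fs feq x1 qE).
rewrite quadratic_cutoff_grad quadratic_cutoff_laplacian.
set S := \sum_i _.
rewrite dotvZl !dotvZr dotvDl dotvZl => Hm.
apply: (@weighted_gradient_algebra n b (phi x1) r^-1 (q x1) S
  (dotv (B *m x1) (grad f x1)) (dotv (B *m x1) (B *m x1))
  (dotv (B *m grad f x1) (grad f x1)) (dotv x1 x1) (dotv (B *m x1) x1)
  (dotv (grad f x1) x1)) => //.
- by rewrite invr_gt0.
- by rewrite invf_le1.
- by rewrite mulrC ler_pdivrMr// mul1r.
- exact: ltW.
- have := dotv_le_half (- (B *m x1)) (grad f x1) ltr01.
  rewrite -scaleN1r !dotvZl (dotvC (B *m x1) (_ *: _)) dotvZl invr1 -/(q x1).
  lra.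
- have := dotv_le_half (B *m grad f x1) (grad f x1) ltr01.
  by have := Bb (grad f x1); rewrite invr1 -/(q x1); lra.
- have := dotv_le_half (B *m x1) x1 ltr01; rewrite invr1; lra.
- by move=> k k0; exact: dotv_le_half.
- exact: laplacian_sqr_le_hessian.
- move: Hm; move: (phi x1) (q x1) S (dotv _ _) (dotv _ _) (dotv _ _) (dotv _ _).
  rewrite -/n => a1 a2 a3 a4 a5 a6 a7; lra.
Qed.

End GradientEstimate.

(** * The logarithmic cutoff and the Hessian form *)

Section Hessian.
Variables (R : realType) (N : nat).
Local Notation V := 'cV[R]_N.
Implicit Types (x y xi : V).

(** The logarithm makes the gradient of the cutoff [O (w / |x|)], so that a drift of linear
    growth contributes only [O (w)], and [w] can be sent to 0. *)
Definition log_cutoff (w : R) (x : V) := 1 + - w * ln (1 + dotv x x).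

Lemma one_plus_dotv_gt0 x : 0 < 1 + dotv x x.
Proof. by rewrite ltr_pwDl// dotv_ge0. Qed.

Lemma one_plus_dotv_smooth : smooth (fun x : V => 1 + dotv x x).
Proof.
apply: constructible_smooth; apply: Cadd; first exact: Ccst.
by apply: Csmooth; exact: dotv_smooth.
Qed.

Lemma log_cutoff_smooth w : smooth (log_cutoff w).
Proof.
apply: constructible_smooth; apply: Cadd; first exact: Ccst.
apply: Cmul; first exact: Ccst.
apply: Csmooth; apply: smooth_ln; first exact: one_plus_dotv_smooth.
exact: one_plus_dotv_gt0.
Qed.

Lemma is_derive_one_plus_dotv x i :
  is_derive x (delta_mx i ord0) (fun y : V => 1 + dotv y y) (2 * x i ord0).
Proof.
have := is_derive_add (is_derive_cst (1 : R) x (delta_mx i ord0)) (is_derive_dotv x i).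
by rewrite add0r.
Qed.

Lemma log_cutoff_partial w i x :
  partial i (log_cutoff w) x = - w * ((1 + dotv x x)^-1 * (2 * x i ord0)).
Proof.
rewrite (partialE (is_derive_add (is_derive_cst (1 : R) x _)
  (is_derive_mul (is_derive_cst (- w) x _)
    (is_derive_ln_comp (one_plus_dotv_gt0 x) (is_derive_one_plus_dotv x i))))).
by rewrite mulr0 addr0 add0r.
Qed.

Lemma log_cutoff_grad w x : grad (log_cutoff w) x = (- w * (1 + dotv x x)^-1 * 2) *: x.
Proof.
by apply/matrixP => i j; rewrite (ord1 j) gradE log_cutoff_partial !mxE !mulrA.
Qed.

Lemma log_cutoff_laplacian w x : laplacian (log_cutoff w) x =
  - w * (2 * N%:R * (1 + dotv x x)^-1 - 4 * dotv x x * (1 + dotv x x) ^- 2).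
Proof.
rewrite /laplacian (eq_bigr (fun i => - w * (2 * (1 + dotv x x)^-1
    - 4 * (x i ord0 * x i ord0) * (1 + dotv x x) ^- 2))); last first.
  move=> i _; rewrite (funext (log_cutoff_partial w i)).
  rewrite (partialE (is_derive_mul (is_derive_cst (- w) x _)
   (is_derive_mul
      (is_derive_inv_comp (lt0r_neq0 (one_plus_dotv_gt0 x)) (is_derive_one_plus_dotv x i))
      (is_derive_mul (is_derive_cst (2 : R) x _) (is_derive_coord i x _))))).
  rewrite mxE !eqxx /=; move: (_^-1) (_^-1) (x i ord0) => a1 a2 a3; ring.
rewrite -mulr_sumr sumrB sumr_const card_ord -mulr_suml -mulr_sumr -/(dotv x x).
by rewrite -[_ *+ N]mulr_natr [2 * _ * N%:R]mulrAC.
Qed.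

Variable f : V -> R.
Hypothesis fs : smooth f.

(** The Hessian as a polynomial in the direction, which makes it jointly continuous in
    direction and point. *)
Definition hessian_form xi x :=
  \sum_i xi i ord0 * \sum_j xi j ord0 * partial j (partial i f) x.

Lemma grad_derive xi x i : grad ('D_xi f) x i ord0 = \sum_j xi j ord0 * partial j (partial i f) x.
Proof.
rewrite gradE -(smooth_derive_partial xi i fs) smooth_deriveE; last exact: smooth_partial.
by apply: eq_bigr => j _; rewrite gradE.
Qed.

Lemma hessian_formE xi x : 'D_xi ('D_xi f) x = hessian_form xi x.
Proof.
rewrite smooth_deriveE; last exact: smooth_derive.
by apply: eq_bigr => i _; rewrite grad_derive.
Qed.

Lemma hessian_form_continuous : continuous (fun p : V * V => hessian_form p.1 p.2).
Proof.
move=> p.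
have c1 (i : 'I_N) : (z : V * V).1 i ord0 @[z --> p] --> p.1 i ord0.
  apply: (@continuous_comp _ _ _ fst (fun x : V => x i ord0)); first exact: cvg_fst.
  exact: coord_continuous.
have c2 i j : partial j (partial i f) (z : V * V).2 @[z --> p] --> partial j (partial i f) p.2.
  apply: (@continuous_comp _ _ _ snd (partial j (partial i f))); first exact: cvg_snd.
  exact/smooth_continuous/smooth_partial/smooth_partial.
have csum (h : 'I_N -> V * V -> R) : (forall i, h i q @[q --> p] --> h i p) ->
    \sum_i h i q @[q --> p] --> \sum_i h i p.
  move=> ch; elim: (index_enum _) => [|i s IH].
    by rewrite big_nil; under eq_fun do rewrite big_nil; exact: cvg_cst.
  by rewrite big_cons; under eq_fun do rewrite big_cons; exact: (cvgD (ch i) IH).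
apply: (csum (fun i q => _)) => i; apply: cvgM; first exact: c1.
by apply: (csum (fun j q => _)) => j; apply: cvgM; [exact: c1|exact: c2].
Qed.

(** Symmetry of the Hessian merges the two halves of the product rule. *)
Lemma is_derive_hessian_form (c : R -> V) (t : R) x (v : V) :
  (forall i, is_derive t (1 : R) (fun s => c s i ord0) (v i ord0)) ->
  is_derive t (1 : R) (fun s => hessian_form (c s) x)
    (2 * dotv v (grad ('D_(c t) f) x)).
Proof.
move=> dc; pose H i j := partial j (partial i f) x.
have Hsym i j : H i j = H j i :=
  congr1 (@^~ x) (smooth_deriveC (delta_mx j ord0) (delta_mx i ord0) fs).
have D : is_derive t (1 : R) (fun s => hessian_form (c s) x)
  (\sum_i (c t i ord0 * (\sum_j v j ord0 * H i j)
     + (\sum_j c t j ord0 * H i j) * v i ord0)).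
  apply: is_derive_fsum => i; apply: is_derive_mul => //.
  apply: is_derive_fsum => j.
  rewrite -[v j ord0 * _]add0r -[X in X + _](mulr0 (c t j ord0)) [v j ord0 * _]mulrC.
  by apply: is_derive_mul.
suff -> : 2 * dotv v (grad ('D_(c t) f) x) =
   (\sum_i (c t i ord0 * (\sum_j v j ord0 * H i j)
     + (\sum_j c t j ord0 * H i j) * v i ord0)) by [].
rewrite big_split /= mulr_natl mulr2n; congr (_ + _).
  under [RHS]eq_bigr do rewrite mulr_sumr.
  rewrite exchange_big /=; apply: eq_bigr => j _; rewrite grad_derive mulr_sumr.
  by apply: eq_bigr => i _; rewrite -/(H j i) (Hsym j i) mulrCA.
by apply: eq_bigr => i _; rewrite grad_derive mulrC.
Qed.

End Hessian.

(** * Nonnegativity of the Hessian of the logarithm *)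

Section HessianSign.
Variables (R : realType) (N : nat) (B : 'M[R]_N).
Local Notation V := 'cV[R]_N.
Implicit Types (x y xi : V).

Lemma partial_opp (g : V -> R) i y : smooth g -> partial i (fun z => - g z) y = - partial i g y.
Proof. by move=> gs; apply: partialE; apply: is_deriveN; exact: is_derive_partial. Qed.

Lemma laplacian_drift_opp (g : V -> R) (x b : V) : smooth g ->
  laplacian (fun y => - g y) x + dotv b (grad (fun y => - g y) x) =
  - (laplacian g x + dotv b (grad g x)).
Proof.
move=> gs; rewrite [LHS]laplacian_drift_sum [X in _ = - X]laplacian_drift_sum -sumrN.
apply: eq_bigr => i _; rewrite (funext (fun y => partial_opp i y gs)).
by rewrite (partial_opp i x (smooth_partial i gs)) mulrN opprD.
Qed.

(** Every term of the right-hand side carries a factor [w], since the growth of the drift is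
    compensated by [rho^-1]; the left-hand side is quadratic in [F]. *)
Lemma weighted_hessian_algebra (n a w p M F S T rho e : R) :
  0 <= n -> 0 <= a -> 0 < w -> w <= 1 -> 0 < p -> p <= 1 -> 0 < M -> 0 < F -> 0 <= T ->
  rho = 1 + T -> 2 * e <= (a + 1) * rho -> F ^+ 2 <= M * S ->
  p ^+ 2 * (2 * S) <= F * (6 * (- w * rho^-1 * 2 * (- w * rho^-1 * 2 * T))
     - 2 * p * (- w * (2 * n * rho^-1 - 4 * T * rho ^- 2) + - w * rho^-1 * 2 * e)) ->
  F * p ^+ 2 <= w * (M * (24 + 4 * n + 2 * (a + 1))).
Proof.
move=> n0 a0 w0 w1 p0 p1 M0 F0 T0 rhoE He HS Hmax.
have r1 : 1 <= rho by lra.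
have r0 : 0 < rho by lra.
set u := rho^-1 in Hmax *; have u0 : 0 < u by rewrite invr_gt0.
have u1 : u <= 1 by rewrite invf_le1.
have ur : u * rho = 1 by rewrite mulVf// gt_eqF.
rewrite -exprVn -/u in Hmax.
have uT : u * T <= 1 by rewrite -ur ler_pM2l//; lra.
have pw : p * w <= w by rewrite ger_pMl.
have pw0 : 0 < p * w by rewrite mulr_gt0.
have K1 : 6 * ((w * u * 2) ^+ 2 * T) <= 24 * w.
  rewrite (_ : 6 * _ = 24 * w * (w * u * (u * T))); last by ring.
  rewrite ger_pMr ?mulr_gt0//.
  have : w * u <= 1 by nra.
  have : 0 < w * u by rewrite mulr_gt0.
  by nra.
have K2 : p * w * (n * u) <= w * n.
  have : n * u <= n by rewrite ler_piMr.
  have : 0 <= n * u by rewrite mulr_ge0// ltW.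
  nra.
have K3 : 0 <= p * w * (T * u ^+ 2) by rewrite mulr_ge0 ?(ltW pw0)// mulr_ge0// sqr_ge0.
have K4 : p * w * (u * (2 * e)) <= w * (a + 1).
  have : u * (2 * e) <= u * ((a + 1) * rho) by rewrite ler_pM2l.
  rewrite (_ : u * ((a + 1) * rho) = a + 1); last by rewrite mulrCA ur mulr1.
  move=> h; apply: (@le_trans _ _ (p * w * (a + 1))); first by rewrite ler_pM2l.
  by rewrite ler_wpM2r//; lra.
set K := _ - _ in Hmax.
have HK : K <= w * (24 + 4 * n + 2 * (a + 1)).
  rewrite /K (_ : 6 * _ - _ = 6 * ((w * u * 2) ^+ 2 * T) + 4 * (p * w * (n * u))
     - 8 * (p * w * (T * u ^+ 2)) + 2 * (p * w * (u * (2 * e)))); last by ring.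
  lra.
have H1 : p ^+ 2 * F ^+ 2 * 2 <= F * (M * K).
  apply: (@le_trans _ _ (M * (p ^+ 2 * (2 * S)))).
    have -> : M * (p ^+ 2 * (2 * S)) = p ^+ 2 * (M * S) * 2 by ring.
    by rewrite ler_pM2r// ler_wpM2l// sqr_ge0.
  by rewrite [leRHS]mulrCA ler_pM2l.
have H2 : F * p ^+ 2 * 2 <= M * K.
  rewrite -(ler_pM2l F0); apply: le_trans H1.
  by rewrite (_ : F * (_ * _ * 2) = p ^+ 2 * F ^+ 2 * 2)//; ring.
have H3 : M * K <= M * (w * (24 + 4 * n + 2 * (a + 1))) by rewrite ler_pM2l.
have H4 : 0 <= F * p ^+ 2 by rewrite mulr_ge0 ?sqr_ge0// ltW.
rewrite mulrCA; lra.
Qed.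

Variable f : V -> R.
Hypothesis fs : smooth f.
Hypothesis feq : forall x, L0 B f x + dotv (grad f x) (grad f x) = 0.

Variables (K : set V) (M : R).
Hypothesis K_compact : compact K.
Hypothesis K_bound : forall xi, K xi -> dotv xi xi <= M.
Hypothesis K_invariant : forall xi, K xi -> exists c : R -> V,
  [/\ c 0 = xi, forall t, K (c t) &
      forall (t : R) i, is_derive t (1 : R) (fun s => c s i ord0) ((B *m c t) i ord0)].

(** A minimiser over an invariant set is critical along the flow line through it. *)
Lemma invariant_critical xi x : K xi -> (forall eta, K eta ->
    hessian_form f xi x <= hessian_form f eta x) ->
  dotv (B *m xi) (grad ('D_xi f) x) = 0.
Proof.
move=> Kxi xmin; have [c [c0 Kc dc]] := K_invariant Kxi.
have D (t : R) := is_derive_hessian_form fs x (dc t).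
have : is_derive (0 : R) (1 : R) (fun s => hessian_form f (c s) x) 0.
  apply: (@derive1_at_min _ _ (-1) 1).
  - by lra.
  - by move=> t _; case: (D t).
  - by rewrite in_itv /=; lra.
  - by move=> t _; rewrite c0; apply: xmin.
move=> /(is_derive_unique (fun=> erefl) (D 0)); rewrite c0 => /eqP.
by rewrite mulf_eq0 pnatr_eq0 /= => /eqP.
Qed.

(** The weighted negative part of the Hessian is maximised over [K] and over the points where
    the cutoff is nonnegative. *)
Lemma weighted_hessian_bound : 0 < M -> exists C, forall w xi x, K xi ->
  0 < w -> w <= 1 -> 0 <= log_cutoff w x ->
  - hessian_form f xi x * log_cutoff w x ^+ 2 <= w * C.
Proof.
move=> M0.
have [b b0 Bb] := mulmx_dotv_bound B.
have [Cq Cq0 Hq] := gradient_growth fs feq.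
pose n : R := N%:R; have n0 : 0 <= n by rewrite /n ler0n.
(* [a + 1] is the constant that [dotv_drift_le] produces. *)
pose a := 2 * b + 8 * Cq.
have a0 : 0 <= a by rewrite /a; lra.
exists (M * (24 + 4 * n + 2 * (a + 1))) => w xi x Kxi w0 w1 px.
pose phi : V -> R := log_cutoff w.
have phis : smooth phi by exact: log_cutoff_smooth.
have lnge0 (y : V) : 0 <= ln (1 + dotv y y) by apply: ln_ge0; rewrite lerDl dotv_ge0.
have phi1 y : phi y <= 1.
  by rewrite /phi /log_cutoff mulNr gerBl mulr_ge0// ltW.
have phir y : 0 <= phi y -> dotv y y <= expR w^-1.
  rewrite /phi /log_cutoff mulNr subr_ge0 mulrC -ler_pdivlMr// mul1r => H.
  apply: (@le_trans _ _ (1 + dotv y y)); first by rewrite lerDr.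
  by rewrite -[leLHS]lnK ?ler_expR// posrE one_plus_dotv_gt0.
have [||||||xi1 [x1 [K1 p0 xmax]]] :=
  @exists_weighted_max R N K (fun xi x => - hessian_form f xi x) phi (expR w^-1) xi x.
- exact: K_compact.
- by move=> p; apply: cvgN; exact: hessian_form_continuous.
- exact: phis.
- exact: phir.
- exact: Kxi.
- exact: px.
apply: (le_trans (xmax _ _ Kxi px)).
have C0 : 0 <= w * (M * (24 + 4 * n + 2 * (a + 1))).
  by rewrite mulr_ge0 ?ltW// mulr_gt0//; lra.
have [F0|F0] := leP (- hessian_form f xi1 x1) 0.
  by apply: le_trans C0; rewrite mulr_le0_ge0// sqr_ge0.
move: p0; rewrite le_eqVlt => /orP[/eqP<-|p0].
  by rewrite expr0n mulr0.
have crit : dotv (B *m xi1) (grad ('D_xi1 f) x1) = 0.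
  apply: invariant_critical => // eta Keta.
  have := xmax eta x1 Keta (ltW p0).
  by rewrite ler_pM2r ?exprn_gt0// lerN2.
pose fv : V -> R := 'D_xi1 f; pose h : V -> R := 'D_xi1 fv.
have fvs : smooth fv by exact: smooth_derive.
have hs : smooth h by exact: smooth_derive.
have hE : h = hessian_form f xi1 by apply/funext => y; exact: hessian_formE.
pose F : V -> R := fun y => - h y.
have Fs : smooth F.
  rewrite (_ : F = fun y => -1 * h y).
    by apply: constructible_smooth; apply: Cmul; [exact: Ccst|exact: Csmooth].
  by apply/funext => y; rewrite mulN1r.
have near1 : \forall y \near x1, F y * phi y ^+ 2 <= F x1 * phi x1 ^+ 2.
  apply: filterS (near_pos (smooth_continuous phis) p0) => y py.
  by rewrite /F hE; exact: xmax.
have heq := hessian_equation fs feq x1 (erefl fv) (erefl h).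
have := max_principle (B *m x1 + 2 *: grad f x1) Fs phis p0 near1.
rewrite [X in _ * X <= _]laplacian_drift_opp//.
have Eh : laplacian h x1 + dotv (B *m x1 + 2 *: grad f x1) (grad h x1)
   = - (2 * dotv (grad fv x1) (grad fv x1)).
  apply: (etrans (esym (drift_form B f h x1))); move: heq; rewrite crit.
  by move: (L0 _ _ _) (dotv _ _) (dotv _ _) => p1 p2 p3; lra.
rewrite [X in _ * - X <= _]Eh opprK log_cutoff_grad log_cutoff_laplacian dotvZl !dotvZr.
have F1 : F x1 = - hessian_form f xi1 x1 by rewrite /F hE.
rewrite -F1 => Hm.
apply: (@weighted_hessian_algebra n a w (phi x1) M (F x1)
  (dotv (grad fv x1) (grad fv x1)) (dotv x1 x1) (1 + dotv x1 x1)
  (dotv (B *m x1 + 2 *: grad f x1) x1)) => //.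
- by rewrite F1.
- exact: dotv_ge0.
- exact: dotv_drift_le b0 (Bb x1) (Hq x1).
- have -> : F x1 ^+ 2 = dotv xi1 (grad fv x1) ^+ 2.
    by rewrite /F sqrrN /h smooth_deriveE.
  apply: (le_trans (dotv_Cauchy_Schwarz _ _)).
  by rewrite ler_wpM2r ?dotv_ge0// K_bound.
Qed.

(** As [w] tends to 0 the cutoff tends to 1 at any fixed point, and the weighted bound to 0. *)
Theorem hessian_nonneg xi x : 0 < M -> K xi -> 0 <= hessian_form f xi x.
Proof.
move=> M0 Kxi; have [C HC] := weighted_hessian_bound M0.
(* [w <= l^-1] keeps the cutoff at least 1/2 at [x]. *)
pose l : R := 2 * ln (1 + dotv x x) + 1.
have l0 : 0 <= ln (1 + dotv x x) by apply: ln_ge0; rewrite lerDl dotv_ge0.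
have l1 : 1 <= l by rewrite /l; lra.
rewrite -oppr_le0; apply/ler_addgt0Pl => e e0; rewrite addr0.
pose w := Num.min l^-1 (e / (4 * (`|C| + 1))).
have C1 : 0 < 4 * (`|C| + 1) by rewrite mulr_gt0// ltr_wpDl.
have w0 : 0 < w by rewrite lt_min invr_gt0 divr_gt0// andbT; lra.
have wl : w <= l^-1 by rewrite ge_min lexx.
have we : w <= e / (4 * (`|C| + 1)) by rewrite ge_min lexx orbT.
have w1 : w <= 1 by apply: (le_trans wl); rewrite invf_le1//; lra.
have px : 1 / 2 <= log_cutoff w x.
  rewrite /log_cutoff; have : w * l <= 1 by rewrite -ler_pdivlMr ?mul1r//; lra.
  by rewrite /l; nra.
have := HC w xi x Kxi w0 w1 (le_trans _ px).
rewrite divr_ge0// => /(_ isT) H.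
have [//|H0] := leP (- hessian_form f xi x) 0; first by move/le_trans; apply; exact: ltW.
have H4 : - hessian_form f xi x * (1 / 4) <= w * C.
  apply: le_trans H; rewrite ler_pM2l//; nra.
have : w * C <= e / 4.
  have wC : w * C <= w * (`|C| + 1) by rewrite ler_pM2l// (le_trans (ler_norm _))// lerDl.
  apply: (le_trans wC); move: we; rewrite ler_pdivlMr//; lra.
lra.
Qed.

End HessianSign.

(** * The matrix exponential and its flow *)

Section Exponential.
Variables (R : realType) (N : nat) (B : 'M[R]_N).
Local Notation V := 'cV[R]_N.

(** Reduces the exponential series to scalar power series. *)
Lemma mx_cvg_entries m n (u : nat -> 'M[R]_(m, n)) (L : 'M[R]_(m, n)) :
  (forall i j, u k i j @[k --> \oo] --> L i j) -> u k @[k --> \oo] --> L.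
Proof.
move=> uL; apply/cvgrPdist_le => /= e e0; near=> k.
rewrite /Num.Def.normr/= mx_normrE (bigmax_le _ (ltW e0))//= => i _.
rewrite !mxE/=.
move: i; near: k; apply: filter_forall => /= i.
exact: ((cvgrPdist_le _ _).1 (uL i.1 i.2)).
Unshelve. all: by end_near. Qed.

Lemma dotv_power_bound b k x : (forall x, dotv (B *m x) (B *m x) <= b * dotv x x) -> 0 <= b ->
  dotv (B ^+ k *m x) (B ^+ k *m x) <= b ^+ k * dotv x x.
Proof.
move=> Bb b0; elim: k => [|k IH]; first by rewrite expr0 mul1mx mul1r.
rewrite !exprS -mulmxE -mulmxA (le_trans (Bb _))// -mulrA.
by rewrite ler_wpM2l.
Qed.

Lemma power_entry_bound : exists2 b, 0 <= b & forall k i j, `|(B ^+ k) i j| <= b ^+ k.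
Proof.
have [b b0 Bb] := mulmx_dotv_bound B.
exists (1 + b) => [|k i j]; first by rewrite addr_ge0.
have e0 : 0 <= (1 + b) ^+ k by rewrite exprn_ge0// addr_ge0.
rewrite -(@ler_pXn2r _ 2)// ?nnegrE// -normrX ger0_norm ?sqr_ge0//.
have := le_trans (coord_sqr_le _ i) (dotv_power_bound k (delta_mx j ord0) Bb b0).
rewrite -colE mxE dotv_delta mxE !eqxx mulr1 => /le_trans; apply.
rewrite -exprM mulnC exprM; apply: lerXn2r; rewrite ?nnegrE//; last by nra.
by rewrite exprn_ge0// addr_ge0.
Qed.

Definition exp_coefs m i j (k : nat) : R := (k`!%:R)^-1 * (B ^+ (k + m)) i j.

(** The entry of index [i, j] of [B ^ m exp (t B)]; the shift [m] makes differentiation stay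
    inside the family. *)
Definition exp_entry m i j (t : R) := limn (pseries (exp_coefs m i j) t).

Lemma pseries_exp_coefs_cvg m i j t : cvgn (pseries (exp_coefs m i j) t).
Proof.
have [b b0 Bb] := power_entry_bound.
apply: normed_cvg; rewrite /normed_series_of /=.
have E : series (fun k => b ^+ m * exp_coeff (b * `|t|) k) =
    series (b ^+ m *: exp_coeff (b * `|t|)) by [].
apply: (@series_le_cvg _ _ (fun k => b ^+ m * exp_coeff (b * `|t|) k)) => [k|k|k|].
- exact: normr_ge0.
- by rewrite mulr_ge0 ?exprn_ge0// /exp_coeff /= divr_ge0// exprn_ge0// mulr_ge0.
- rewrite /exp_coefs /exp_coeff /= !normrM normfV normrX normr_nat exprMn.
  rewrite [leRHS](_ : _ = k`!%:R^-1 * b ^+ (k + m) * `|t| ^+ k).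
    by rewrite ler_wpM2r ?exprn_ge0// ler_wpM2l// invr_ge0 ler0n.
  rewrite exprD; move: (b ^+ m) (b ^+ k) (`|t| ^+ k) (k`!%:R^-1) => p1 p2 p3 p4; ring.
- rewrite E; apply: is_cvg_seriesZ; exact: is_cvg_series_exp_coeff.
Qed.

Lemma pseries_diffs_exp_coefs m i j : pseries_diffs (exp_coefs m i j) = exp_coefs m.+1 i j.
Proof.
apply/funext => k; rewrite /pseries_diffs /exp_coefs addSnnS factS natrM invfM !mulrA.
by rewrite divff ?mul1r// pnatr_eq0.
Qed.

Lemma is_derive_exp_entry m i j t :
  is_derive t (1 : R) (exp_entry m i j) (exp_entry m.+1 i j t).
Proof.
rewrite /exp_entry -pseries_diffs_exp_coefs.
apply: (@pseries_snd_diffs _ _ (`|t| + 1)); rewrite ?pseries_diffs_exp_coefs;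
  try exact: pseries_exp_coefs_cvg.
by rewrite [ltRHS]ger0_norm ?addr_ge0// ltrDl.
Qed.

Lemma expmx_entry t i j : expmx (t *: B) i j = exp_entry 0 i j t.
Proof.
pose L : 'M[R]_N := \matrix_(i, j) exp_entry 0 i j t.
have powZ k : (t *: B) ^+ k = t ^+ k *: B ^+ k.
  elim: k => [|k IH]; first by rewrite !expr0 scale1r.
  by rewrite !exprS IH -!mulmxE -scalemxAl -scalemxAr scalerA.
have seriesE k i' j' : series (fun k : nat => (k`!%:R)^-1 *: (t *: B) ^+ k) k i' j'
    = pseries (exp_coefs 0 i' j') t k.
  rewrite /pseries /series /= summxE; apply: eq_bigr => l _.
  by rewrite powZ !mxE /exp_coefs addn0 mulrCA mulrC.
have -> : expmx (t *: B) = L; last by rewrite mxE.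
  apply/cvg_lim => //.
  apply: mx_cvg_entries => i' j'; rewrite mxE; under eq_fun do rewrite seriesE.
  exact: pseries_exp_coefs_cvg.
Qed.

(** Linear relations between entries of powers pass to the sums of the series; used for the
    products of [B] and the exponential in both orders. *)
Lemma exp_entry_sum m n i j (a : 'I_n -> R) (i' j' : 'I_n -> 'I_N) m' t :
  (forall k, (B ^+ (k + m)) i j = \sum_l a l * (B ^+ (k + m')) (i' l) (j' l)) ->
  exp_entry m i j t = \sum_l a l * exp_entry m' (i' l) (j' l) t.
Proof.
move=> H; apply/cvg_lim => //.
rewrite (_ : pseries _ t = fun k => \sum_l a l * pseries (exp_coefs m' (i' l) (j' l)) t k).
  elim: (index_enum _) => [|l s IH].
    by rewrite big_nil; under eq_fun do rewrite big_nil; exact: cvg_cst.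
  rewrite big_cons; under eq_fun do rewrite big_cons.
  apply: (cvgD _ IH); apply: cvgM; first exact: cvg_cst.
  exact: pseries_exp_coefs_cvg.
apply/funext => k; rewrite /pseries /series /=.
under [RHS]eq_bigr do rewrite mulr_sumr.
rewrite exchange_big /=; apply: eq_bigr => q _.
rewrite /exp_coefs H mulr_sumr mulr_suml; apply: eq_bigr => l _.
by rewrite !mulrA [a l * _]mulrC.
Qed.

Lemma exp_entry_mulBl i j t : exp_entry 1 i j t = \sum_l B i l * exp_entry 0 l j t.
Proof.
apply: (exp_entry_sum (i' := id) (j' := fun=> j)) => k.
by rewrite addn1 addn0 exprS -mulmxE mxE.
Qed.

Lemma exp_entry_mulBr i j t : exp_entry 1 i j t = \sum_l B l j * exp_entry 0 i l t.
Proof.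
apply: (exp_entry_sum (i' := fun=> i) (j' := id)) => k.
by rewrite addn1 addn0 exprSr -mulmxE mxE; apply: eq_bigr => l _; rewrite mulrC.
Qed.

Lemma exp_entry0 i j : exp_entry 0 i j 0 = (i == j)%:R.
Proof.
apply/cvg_lim => //; apply: cvg_near_cst; exists 1%N => // -[//|k] _.
rewrite /pseries /series /= big_nat_recl// big1 ?addr0 => [|l _].
  by rewrite /exp_coefs /= addn0 !expr0 mulr1 invr1 mul1r mxE.
by rewrite expr0n mulr0.
Qed.

Definition flow (xi : V) (t : R) : V := expmx (t *: B) *m xi.

Lemma flow_coord xi t i : flow xi t i ord0 = \sum_j exp_entry 0 i j t * xi j ord0.
Proof. by rewrite mxE; apply: eq_bigr => j _; rewrite expmx_entry. Qed.

Lemma flow0 xi : flow xi 0 = xi.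
Proof.
apply/matrixP => i j; rewrite (ord1 j) flow_coord (bigD1 i)//= big1 => [|k ki].
  by rewrite exp_entry0 eqxx mul1r addr0.
by rewrite exp_entry0 eq_sym (negbTE ki) mul0r.
Qed.

Lemma flow_is_derive xi t i :
  is_derive t (1 : R) (fun s => flow xi s i ord0) ((B *m flow xi t) i ord0).
Proof.
rewrite (_ : (fun s => _) = fun s => \sum_j exp_entry 0 i j s * xi j ord0); last first.
  by apply/funext => s; rewrite flow_coord.
have -> : (B *m flow xi t) i ord0 =
    \sum_j (exp_entry 0 i j t * 0 + xi j ord0 * exp_entry 1 i j t).
  rewrite mxE; under eq_bigr do rewrite flow_coord mulr_sumr.
  rewrite exchange_big /=; apply: eq_bigr => j _.
  rewrite mulr0 add0r exp_entry_mulBl mulr_sumr; apply: eq_bigr => k _.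
  by rewrite mulrA mulrC.
apply: is_derive_fsum => j; apply: is_derive_mul; exact: is_derive_exp_entry.
Qed.

Lemma exp_entry_rev i j u s :
  is_derive s (1 : R) (fun s => exp_entry 0 i j (u - s)) (- exp_entry 1 i j (u - s)).
Proof.
rewrite -mulrN1; apply: (@is_derive1_comp _ (exp_entry 0 i j) (fun s => u - s)).
  exact: is_derive_exp_entry.
have : is_derive s (1 : R) (cst u - id) (0 - 1 : R) by apply: is_deriveB.
by rewrite sub0r.
Qed.

(** The curve [r -> exp ((t + s - r) B) exp (r B) xi] is constant, because its derivative
    contains [B] once with each sign. *)
Lemma flow_flow xi s t : flow (flow xi s) t = flow xi (t + s).
Proof.
apply/matrixP => i j; rewrite (ord1 j) => {j}.
(* Evaluated at [r = s] and at [r = 0], this gives the two sides. *)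
pose w r := flow (flow xi r) (t + s - r) i ord0.
have dw r : is_derive r (1 : R) w 0.
  rewrite /w (_ : (fun r => _) =
      fun r => \sum_j exp_entry 0 i j (t + s - r) * flow xi r j ord0); last first.
    by apply/funext => r'; rewrite flow_coord.
  have D := is_derive_fsum
    (fun j => is_derive_mul (exp_entry_rev i j (t + s) r) (flow_is_derive xi r j)).
  suff Z : \sum_j (exp_entry 0 i j (t + s - r) * (B *m flow xi r) j ord0 +
     flow xi r j ord0 * - exp_entry 1 i j (t + s - r)) = 0 by rewrite Z in D.
  rewrite big_split /= addrC; apply/eqP.
  under eq_bigr do rewrite mulrN; rewrite sumrN addrC subr_eq0; apply/eqP.
  under eq_bigr do rewrite mxE mulr_sumr.
  under [RHS]eq_bigr do rewrite exp_entry_mulBr mulr_sumr.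
  rewrite exchange_big /=; apply: eq_bigr => k _; apply: eq_bigr => l _.
  by rewrite mulrC mulrAC mulrC.
have := is_derive_0_is_cst s 0 dw.
by rewrite /w addrK subr0 flow0.
Qed.

End Exponential.

(** * Bounded orbits *)

Section OperatorNorm.
Variables (R : realType) (N : nat).
Local Notation V := 'cV[R]_N.

(** The supremum that defines [opnorm] is over a bounded set by [mulmx_dotv_bound]. *)
Lemma enorm_le_opnorm (A : 'M[R]_N) (y : V) : enorm y <= 1 -> enorm (A *m y) <= opnorm A.
Proof.
have [b b0 Ab] := mulmx_dotv_bound A.
move=> y1; apply: ub_le_sup; last by exists y.
exists (Num.sqrt b) => _ [z /= z1 <-]; apply: ler_wsqrtr; apply: (le_trans (Ab z)).
rewrite ler_piMr// -[leLHS]sqr_sqrtr ?dotv_ge0// -/(enorm z).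
by rewrite exprn_ile1// sqrtr_ge0.
Qed.

Lemma opnorm_ge0 (A : 'M[R]_N) : 0 <= opnorm A.
Proof.
apply: le_trans (enorm_le_opnorm A (y := 0) _); first exact: sqrtr_ge0.
by rewrite /enorm /dotv big1 ?sqrtr0// => i _; rewrite mxE mul0r.
Qed.

(** Homogeneity reduces to the unit ball. *)
Lemma dotv_opnorm (A : 'M[R]_N) (x : V) :
  dotv (A *m x) (A *m x) <= opnorm A ^+ 2 * dotv x x.
Proof.
have [b b0 Ab] := mulmx_dotv_bound A.
have [x0|x0] := eqVneq (dotv x x) 0.
  by apply: (le_trans (Ab x)); rewrite x0 !mulr0.
have x1 : 0 < dotv x x by rewrite lt_def x0 dotv_ge0.
pose c := (Num.sqrt (dotv x x))^-1.
have c2 : c ^+ 2 = (dotv x x)^-1 by rewrite exprVn sqr_sqrtr ?ltW.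
have cE (y : V) : dotv (c *: y) (c *: y) = c ^+ 2 * dotv y y.
  by rewrite dotvZl dotvZr mulrA.
have : enorm (c *: x) <= 1 by rewrite /enorm cE c2 mulVf// sqrtr1.
move=> /(enorm_le_opnorm A) h; have : enorm (A *m (c *: x)) ^+ 2 <= opnorm A ^+ 2.
  by apply: lerXn2r; rewrite ?nnegrE ?sqrtr_ge0 ?opnorm_ge0.
rewrite /enorm sqr_sqrtr ?dotv_ge0// -scalemxAr cE c2 mulrC ler_pdivrMr//.
Qed.

Lemma bounded_flow (B : 'M[R]_N) :
  (ereal_sup (range (fun t : R => (opnorm (expmx (- t *: B)))%:E)) < +oo)%E ->
  exists2 m, 0 <= m & forall (xi : V) t, dotv (flow B xi t) (flow B xi t) <= m * dotv xi xi.
Proof.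
move=> hB.
have [m Hm] : exists m : R, forall t, opnorm (expmx (t *: B)) <= m.
  have ub t : ((opnorm (expmx (t *: B)))%:E <=
      ereal_sup (range (fun t : R => (opnorm (expmx (- t *: B)))%:E)))%E.
    apply: ereal_sup_ubound; exists (- t); first exact: I.
    by rewrite opprK.
  case: (ereal_sup _) hB ub => [m _ ub|//|_ ub].
    by exists m => t; have := ub t; rewrite lee_fin.
  by exists 0 => t; have := ub t; rewrite leeNy_eq.
exists (m ^+ 2); first exact: sqr_ge0.
move=> xi t; apply: (le_trans (dotv_opnorm _ _)); rewrite ler_wpM2r ?dotv_ge0//.
by apply: lerXn2r; rewrite ?nnegrE ?opnorm_ge0//; apply: le_trans (Hm t); exact: opnorm_ge0.
Qed.

End OperatorNorm.

Section Orbit.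
Variables (R : realType) (N : nat) (B : 'M[R]_N).
Local Notation V := 'cV[R]_N.

(** The bound is imposed on the whole orbit, so that the set is invariant under the flow;
    being closed and bounded, it is also compact. *)
Definition bounded_orbits (M : R) : set V :=
  [set xi | forall t, dotv (flow B xi t) (flow B xi t) <= M].

Lemma dotv_mulmx_continuous (A : 'M[R]_N) : continuous (fun x : V => dotv (A *m x) (A *m x)).
Proof.
apply: smooth_continuous; apply: constructible_smooth; apply: constructible_sum => i.
have C : constructible (fun x : V => (A *m x) i ord0).
  rewrite (_ : (fun x => _) = fun x : V => \sum_j A i j * x j ord0); last first.
    by apply/funext => x; rewrite mxE.
  by apply: constructible_sum => j; apply: Cmul; [exact: Ccst|exact: Ccoord].
exact: Cmul.
Qed.

Lemma bounded_orbits_le M xi : bounded_orbits M xi -> dotv xi xi <= M.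
Proof. by move=> /(_ 0); rewrite flow0. Qed.

Lemma bounded_orbits_compact M : compact (bounded_orbits M).
Proof.
apply: (bounded_closed_compact_cV (r := M)); first exact: bounded_orbits_le.
rewrite (_ : bounded_orbits M = \bigcap_(t in [set: R])
   [set xi | 0 <= M - dotv (flow B xi t) (flow B xi t)]); last first.
  apply/seteqP; split => [xi H t _ /=|xi H t]; first by rewrite subr_ge0.
  by have := H t I; rewrite /= subr_ge0.
apply: closed_bigI => t _; apply: closed_nonneg => x.
exact: (cvgB (cvg_cst _) (@dotv_mulmx_continuous (expmx (t *: B)) x)).
Qed.

Lemma bounded_orbits_invariant M xi : bounded_orbits M xi -> exists c : R -> V,
  [/\ c 0 = xi, forall t, bounded_orbits M (c t) &
      forall (t : R) i, is_derive t (1 : R) (fun s => c s i ord0) ((B *m c t) i ord0)].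
Proof.
move=> H; exists (flow B xi); split; first exact: flow0.
  by move=> t s; rewrite flow_flow.
by move=> t i; exact: flow_is_derive.
Qed.

Hypothesis hB :
  (ereal_sup (range (fun t : R => (opnorm (expmx (- t *: B)))%:E)) < +oo)%E.

(** Every direction belongs to some set [bounded_orbits M], as the flow is uniformly bounded. *)
Theorem log_convexity (u : V -> R) xi x : smooth u -> (forall y, 0 < u y) ->
  (forall y, L0 B u y = 0) -> 0 <= 'D_xi ('D_xi (fun y => ln (u y))) x.
Proof.
move=> us u0 Lu.
have lus := smooth_ln us u0.
have [m m0 Hm] := bounded_flow hB.
have M0 : 0 < m * dotv xi xi + 1 by rewrite ltr_wpDl// mulr_ge0// dotv_ge0.
rewrite hessian_formE//.
apply: (hessian_nonneg lus _ (@bounded_orbits_compact _) (@bounded_orbits_le _)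
   (@bounded_orbits_invariant _) x M0).
  by move=> y; exact: log_equation.
by move=> t; apply: (le_trans (Hm xi t)); rewrite lerDl.
Qed.

End Orbit.

(** * Convexity and the Liouville property *)

(** The mean value theorem is used twice: for [dg], which is then monotone, and for [g]. *)
Lemma tangent_below (R : realType) (g dg ddg : R -> R) (a b : R) :
  (forall s : R, is_derive s (1 : R) g (dg s)) ->
  (forall s : R, is_derive s (1 : R) dg (ddg s)) ->
  (forall s, 0 <= ddg s) -> g a + dg a * (b - a) <= g b.
Proof.
move=> Dg Ddg pos.
have cont (h dh : R -> R) (i : interval R) : (forall s : R, is_derive s (1 : R) h (dh s)) ->
    {within [set` i], continuous h}.
  by move=> Dh; apply: derivable_within_continuous => s _; case: (Dh s).
have mono x y : x <= y -> dg x <= dg y.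
  move=> xy; have [c _ E] := MVT_segment xy (fun s _ => Ddg s) (cont _ _ _ Ddg).
  by rewrite -subr_ge0 E mulr_ge0// subr_ge0.
have [ab|/ltW ba] := leP a b.
  have [c] := MVT_segment ab (fun s _ => Dg s) (cont _ _ _ Dg).
  rewrite in_itv /= => /andP[ac _] E.
  rewrite -lerBrDl E ler_wpM2r ?subr_ge0//; exact: mono.
have [c] := MVT_segment ba (fun s _ => Dg s) (cont _ _ _ Dg).
rewrite in_itv /= => /andP[_ ca] E.
have : dg c * (a - b) <= dg a * (a - b) by rewrite ler_wpM2r ?subr_ge0//; exact: mono.
by rewrite -E; lra.
Qed.

Section Convexity.
Variables (R : realType) (N : nat).
Local Notation V := 'cV[R]_N.
Variable (k : V -> R).
Hypothesis ks : smooth k.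
Hypothesis kconv : forall xi x, 0 <= 'D_xi ('D_xi k) x.

Lemma convex_line x (a b : R) :
  k (a *: x) + 'D_x k (a *: x) * (b - a) <= k (b *: x).
Proof.
have E (s : R) : s *: x = s *: x + 0 by rewrite addr0.
rewrite (E a) (E b).
apply: (tangent_below (g := fun s => k (s *: x + 0)) (dg := fun s => 'D_x k (s *: x + 0))
   (ddg := fun s => 'D_x ('D_x k) (s *: x + 0))) => s.
- by apply: is_derive_line; exact: smooth_derivable.
- by apply: is_derive_line; apply: smooth_derivable; exact: smooth_derive.
- exact: kconv.
Qed.

Lemma convex_min x : grad k 0 = 0 -> k 0 <= k x.
Proof.
move=> g0; have := convex_line x 0 1; rewrite scale0r scale1r smooth_deriveE// g0.
by rewrite dotvC /dotv big1 ?mul0r ?addr0// => i _; rewrite mxE mul0r.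
Qed.

(** Add the tangent inequalities at the midpoint towards both ends. *)
Lemma convex_mid x : 2 * k (2^-1 *: x) <= k 0 + k x.
Proof.
have := convex_line x 2^-1 0; have := convex_line x 2^-1 1.
rewrite scale0r scale1r; move: (k _) (k _) (k _) (derive _ _ _) => p1 p2 p3 p4; lra.
Qed.

End Convexity.

Section Shift.
Variables (R : realType) (N : nat) (B : 'M[R]_N).
Local Notation V := 'cV[R]_N.
Variable (v : V -> R).
Hypothesis vs : smooth v.
Variable c : R.
Let u x := v x + - c.

Lemma shift_smooth : smooth u.
Proof.
by apply: constructible_smooth; apply: Cadd; [exact: Csmooth|exact: Ccst].
Qed.

Lemma derive_shift xi : 'D_xi u = 'D_xi v.
Proof.
apply/funext => x; have dv : is_derive x xi v ('D_xi v x) by apply/derivableP/smooth_derivable.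
by case: (is_derive_add dv (is_derive_cst (- c) x xi)) => _ ->; rewrite addr0.
Qed.

Lemma L0_shift x : L0 B u x = L0 B v x.
Proof.
rewrite /L0; have E i : partial i u = partial i v := derive_shift _.
have -> : laplacian u x = laplacian v x.
  by apply: eq_bigr => i _; exact: (congr1 (fun g : V -> R => partial i g x) (E i)).
congr (_ + dotv _ _); apply/matrixP => i j.
by rewrite (ord1 j) !gradE; exact: (congr1 (fun g : V -> R => g x) (E i)).
Qed.

End Shift.

Section Liouville.
Variables (R : realType) (N : nat) (B : 'M[R]_N).
Local Notation V := 'cV[R]_N.
Variable (v : V -> R).
Hypothesis hB :
  (ereal_sup (range (fun t : R => (opnorm (expmx (- t *: B)))%:E)) < +oo)%E.
Hypothesis vs : smooth v.
Hypothesis vsol : forall x, L0 B v x = 0.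

Lemma log_shift_convex c xi x : (forall y, c < v y) ->
  0 <= 'D_xi ('D_xi (fun y => ln (v y + - c))) x.
Proof.
move=> cv; apply: (log_convexity hB) => [|y|y].
- exact: shift_smooth.
- by rewrite subr_gt0.
- by rewrite L0_shift.
Qed.

(** This is the convexity of [ln (v - c)] written in terms of [v]. *)
Lemma derive_sqr_le c xi x : (forall y, c < v y) ->
  'D_xi v x ^+ 2 <= (v x + - c) * 'D_xi ('D_xi v) x.
Proof.
move=> cv; have u0 y : 0 < v y + - c by rewrite subr_gt0.
have := log_shift_convex xi x cv.
rewrite derive_derive_ln//; last exact: shift_smooth.
have E := derive_shift vs c xi.
have -> : 'D_xi (fun y => v y + - c) x = 'D_xi v x := congr1 (fun g : V -> R => g x) E.
have -> : 'D_xi ('D_xi (fun y => v y + - c)) x = 'D_xi ('D_xi v) x :=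
  congr1 (fun g : V -> R => 'D_xi g x) E.
move: ('D_xi ('D_xi v) x) ('D_xi v x) (u0 x); move: (v x + - c) => u d2 d1 up H.
have : 0 <= u ^+ 2 * (u^-1 * d2 + d1 * (- u ^- 2 * d1)).
  by apply: mulr_ge0; [exact: sqr_ge0|exact: H].
have -> : u ^+ 2 * (u^-1 * d2 + d1 * (- u ^- 2 * d1)) = u * d2 - d1 ^+ 2.
  by field; rewrite gt_eqF.
by rewrite subr_ge0.
Qed.

(** At the origin the drift vanishes, so the Laplacian does; the second derivatives, being
    nonnegative, all vanish, and [derive_sqr_le] then kills the first ones. *)
Lemma grad_origin c : (forall y, c < v y) -> grad v 0 = 0.
Proof.
move=> cv; have u0 : 0 < v 0 + - c by rewrite subr_gt0.
have H i : partial i v 0 ^+ 2 <= (v 0 + - c) * partial i (partial i v) 0.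
  exact: (derive_sqr_le (delta_mx i ord0) 0 cv).
have pos i : 0 <= partial i (partial i v) 0.
  by rewrite -(pmulr_rge0 _ u0); apply: le_trans (H i); exact: sqr_ge0.
have : laplacian v 0 = 0.
  have := vsol 0; rewrite /L0 mulmx0 [dotv 0 _]/dotv big1 ?addr0// => i _.
  by rewrite mxE mul0r.
move=> /eqP; rewrite psumr_eq0 => [/allP /= z|i _]; last exact: pos.
apply/matrixP => i j; rewrite (ord1 j) gradE mxE; apply/eqP.
have /eqP zi := z i (mem_index_enum i).
by rewrite -sqrf_eq0 eq_le sqr_ge0 andbT (le_trans (H i))// zi mulr0.
Qed.

Lemma grad_ln_origin c : (forall y, c < v y) -> grad (fun y => ln (v y + - c)) 0 = 0.
Proof.
move=> cv; apply/matrixP => i j; rewrite (ord1 j) gradE mxE.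
have u0 : 0 < v 0 + - c by rewrite subr_gt0.
have D : is_derive (0 : V) (delta_mx i ord0) (fun y => v y + - c) (partial i v 0 + 0).
  exact: is_derive_add (is_derive_partial i 0 vs) (is_derive_cst (- c) (0 : V) _).
rewrite (partialE (is_derive_ln_comp u0 D)) addr0.
by rewrite -gradE (grad_origin cv) mxE mulr0.
Qed.

(** A convex function is minimal at a critical point. *)
Lemma min_at_origin c x : (forall y, c < v y) -> v 0 <= v x.
Proof.
move=> cv; have u0 y : 0 < v y + - c by rewrite subr_gt0.
have ks : smooth (fun y => ln (v y + - c)) := smooth_ln (shift_smooth vs c) u0.
have := convex_min ks (fun xi y => log_shift_convex xi y cv) x (grad_ln_origin cv).
by rewrite ler_ln ?posrE// lerD2r.
Qed.

Lemma log_midpoint c x : (forall y, c < v y) ->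
  (v (2^-1 *: x) - c) ^+ 2 <= (v 0 - c) * (v x - c).
Proof.
move=> cv; have u0 y : 0 < v y + - c by rewrite subr_gt0.
have ks : smooth (fun y => ln (v y + - c)) := smooth_ln (shift_smooth vs c) u0.
have := convex_mid ks (fun xi y => log_shift_convex xi y cv) x.
rewrite mulr_natl -lnXn// -lnM ?posrE// ler_ln ?posrE ?exprn_gt0// mulr_gt0//.
Qed.

(** Since [v 0] is the minimum, midpoint convexity of [ln (v - c)] holds for all [c < v 0]. As
    [c] tends to [v 0] it forces [v (x / 2) = v 0]. *)
Theorem constant_of_lower_bound c x : (forall y, c < v y) -> v x = v 0.
Proof.
move=> cv; have min y : v 0 <= v y := min_at_origin y cv.
have half y : v (2^-1 *: y) = v 0.
  apply/eqP; rewrite eq_le min andbT -subr_le0.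
  have D0 : 0 <= v y - v 0 by rewrite subr_ge0.
  have d0 : 0 <= v (2^-1 *: y) - v 0 by rewrite subr_ge0.
  have H e : 0 < e -> (v (2^-1 *: y) - v 0 + e) ^+ 2 <= e * (v y - v 0 + e).
    move=> e0; have ce z : v 0 - e < v z.
      by apply: lt_le_trans (min z); rewrite ltrBlDr ltrDl.
    by have := log_midpoint y ce; rewrite !opprB !addrA; rewrite [v 0 + e]addrC addrK
      ![_ + e - v 0]addrAC.
  move: H D0 d0; move: (v (2^-1 *: y) - v 0) (v y - v 0) => d D H D0 d0.
  rewrite leNgt; apply/negP => dpos.
  (* For this [e] the right-hand side of [H] is at most [d ^ 2 / 2]. *)
  pose e := Num.min 1 (d ^+ 2 / (2 * (D + 1))).
  have D1 : 0 < 2 * (D + 1) by lra.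
  have e0 : 0 < e by rewrite lt_min ltr01 divr_gt0// exprn_gt0.
  have e1 : e <= 1 by rewrite ge_min lexx.
  have e2 : e * (2 * (D + 1)) <= d ^+ 2 by rewrite -ler_pdivlMr// ge_min lexx orbT.
  have := H e e0; have : 0 < d ^+ 2 by rewrite exprn_gt0.
  nra.
by rewrite -(half (2 *: x)) scalerA mulVf ?pnatr_eq0// scale1r.
Qed.

End Liouville.

Unset Implicit Arguments.

Theorem theorem1p1 (R : realType) (N : nat) (B : 'M[R]_N) (v : 'cV[R]_N -> R)
  (hB : (ereal_sup (range (fun t : R => (opnorm (expmx (- t *: B)))%:E)) < +oo)%E)
  (v_smooth : smooth v)
  (v_sol : forall x : 'cV[R]_N, L0 B v x = 0)
  (v_inf : (-oo < ereal_inf (range (fun x : 'cV[R]_N => (v x)%:E)))%E) :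
  exists c : R, forall x : 'cV[R]_N, v x = c.
Proof.
have [c cv] : exists c, forall y, c < v y.
  have lb y : (ereal_inf (range (fun x : 'cV[R]_N => (v x)%:E)) <= (v y)%:E)%E.
    by apply: ereal_inf_lbound; exists y.
  case: (ereal_inf _) v_inf lb => [m _ lb|_ lb|//].
    by exists (m - 1) => y; have := lb y; rewrite lee_fin; lra.
  by have := lb 0; rewrite leye_eq.
exists (v 0) => x; exact: (constant_of_lower_bound hB v_smooth v_sol x cv).
Qed.
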